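(* Set $\alpha=\frac1{30}$. Let $\gamma\in\mathcal{S}(S_{0,4})$ with $\mathrm{Slope}(\gamma)=[n_1(\gamma),\dots,n_{r(\gamma)}(\gamma)]$ the continued fraction expansion of its slope. Fix $0\le i\le r(\gamma)$ such that $l_i(\gamma)\ge10$. Let $W\in\mathbb{F}_3$ be a subword of a cyclic permutation of $\gamma$ or of $\gamma^{-1}$ such that $|W|\ge 3(l'_i(\gamma)+l_i(\gamma)+1)$, and let $w\in\mathbb{F}_3$ be a subword of a cyclic permutation of $\gamma$ or of $\gamma^{-1}$ of length $l_i(\gamma)-5$. Then the word $W$ can be decomposed as a concatenation $W=u_1\cdots u_q$ such that there exists a subset $\mathcal{I}\subset\{1,\dots,q\}$ satisfying: (1) for all $k\in\mathcal{I}$, $u_k\in\{w,w^{-1}\}$; (2) $\displaystyle\sum_{k\in\mathcal{I}}|u_k|\ge\alpha|W|$.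
   Context: The four-punctured sphere $S_{0,4}$ is identified with $(\mathbb{R}^2\setminus\mathbb{Z}^2)/\Gamma$, where $\Gamma$ is the group generated by the translations by $2\mathbb{Z}^2$ and $x\mapsto -x$. Its fundamental group is $\mathbb{F}_3=\langle a,b,c\rangle$, where $a,b,c$ are loops around the punctures corresponding to the classes of $(1,0),(0,1),(1,1)$ modulo $2\mathbb{Z}^2$, and $abc$ is a loop around the fourth puncture (class of $(0,0)$). Explicitly, the word of an oriented curve (up to cyclic permutation) is read by following a lift in $\mathbb{R}^2\setminus\mathbb{Z}^2$ and recording $a^{\pm1}$, $b^{\pm1}$, $c^{\pm1}$ at each crossing with a line $\{y=2k\}$, $\{x=2k\}$, $\{x+y=2k\}$ ($k\in\mathbb{Z}$) respectively. The sign is given by a $\Gamma$-invariant transverse orientation on the segments cut out on these lines by $\mathbb{Z}^2$, determined by: crossing the open segment from $(0,0)$ to $(1,0)$ upward gives $a$; crossing the open segment from $(0,0)$ to $(0,1)$ towards decreasing $x$ gives $b$; crossing the open segment from $(0,2)$ to $(1,1)$ towards increasing $x+y$ gives $c$. A closed curve is simple if it is freely homotopic to a curve without self-intersection and bounds neither a disk nor a once-punctured disk. $\mathcal{S}(S_{0,4})$ is the set of free homotopy classes of unoriented simple closed curves, and $\gamma\in\mathcal{S}(S_{0,4})$ also denotes a cyclically reduced word in $\mathbb{F}_3$ representing it. Every simple closed curve is homotopic to the image of a straight line of slope in $\mathbb{Q}\cup\{\infty\}$ avoiding $\mathbb{Z}^2$; this slope is denoted $\mathrm{Slope}(\gamma)$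 and $\mathrm{Slope}:\mathcal{S}(S_{0,4})\to\mathbb{Q}\cup\{\infty\}$ is a bijection. $|\cdot|$ is reduced word length, $\Vert\cdot\Vert$ cyclically reduced word length. Special lengths: write $\mathrm{Slope}(\gamma)=[n_1,\dots,n_r]=n_1+\frac{1}{n_2+\frac1{\ddots+\frac1{n_r}}}$ with $n_1\in\mathbb{Z}$, $n_2,\dots,n_r\ge1$ and $n_r\ge2$ if $r\ge2$; $r(\gamma)=r$. For $1\le i\le r$ let $\gamma_i,\gamma'_i\in\mathcal{S}(S_{0,4})$ have slopes $[n_1,\dots,n_i]$ and $[n_1,\dots,n_{i-1},n_i+1]$ respectively; let $\gamma_0,\gamma'_0$ have slopes $0$ and $1$. Then $l_i(\gamma)=\frac12\Vert\gamma_i\Vert$ and $l'_i(\gamma)=\frac12\Vert\gamma'_i\Vert$ for $0\le i\le r$. *)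

(* Defs.v *)
From HB Require Import structures.
From mathcomp Require Import all_boot all_order all_algebra.
From mathcomp Require Import all_classical all_reals all_analysis.

Set Implicit Arguments.
Unset Strict Implicit.
Unset Printing Implicit Defensive.

Import Order.TTheory GRing.Theory Num.Theory.
Import numFieldNormedType.Exports.

Local Open Scope classical_set_scope.
Local Open Scope ring_scope.

Variant gen := ga | gb | gc.

Definition gen_code (x : gen) : nat :=
  match x with ga => 0 | gb => 1 | gc => 2 end.

Definition gen_decode (n : nat) : gen :=
  match n with 0%N => ga | 1%N => gb | _ => gc end.

Lemma gen_codeK : cancel gen_code gen_decode.
Proof. by case. Qed.

HB.instance Definition _ := Equality.copy gen (can_type gen_codeK).

(* (x, false) is the generator x and (x, true) is its inverse.  Elements of
   F_3 are handled as reduced words. *)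
Definition letter : Type := (gen * bool)%type.
HB.instance Definition _ := Equality.on letter.

Definition word : Type := seq letter.

Definition linv (x : letter) : letter := (x.1, ~~ x.2).

Definition winv (u : word) : word := rev (map linv u).

(* No letter is followed, cyclically, by its inverse. *)
Definition cyc_reduced (u : word) : bool := cycle (fun x y => y != linv x) u.

Definition cyclic_subword (v u : word) : Prop :=
  exists k : nat, infix v (rot k u).

Section FourPuncturedSphere.
Variable R : realType.

Definition plane : Type := (R * R)%type.

Definition lattice : set plane :=
  [set x | x.1 \is a Num.int /\ x.2 \is a Num.int].

(* The group generated by the translations by 2Z^2 and by x |-> - x consists
   exactly of the maps x |-> x + 2v and x |-> - x + 2v with v in Z^2. *)
Definition Gamma : set (plane -> plane) :=
  [set g | exists (e : bool) (m n : int),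
     forall x : plane, g x = (if e then - x else x)
                             + ((2 * m)%:~R : R, (2 * n)%:~R : R)].

Definition same_orbit (x y : plane) : Prop := exists2 g, Gamma g & y = g x.

(* Gamma acts freely and properly discontinuously on R^2 \ Z^2, so a closed
   curve of the quotient S_{0,4}, i.e. a map defined on R/Z, is the same thing
   as its lift c : R -> R^2 \ Z^2, which is determined up to Gamma.  Curves,
   homotopies and disks in S_{0,4} are all represented by lifts. *)
Definition closed_curve (c : R -> plane) : Prop :=
  [/\ continuous c,
      forall t, ~ lattice (c t)
    & exists2 g, Gamma g & forall t, c (t + 1) = g (c t)].

Definition rev_curve (c : R -> plane) : R -> plane := fun t => c (- t).

Definition free_homotopic (c0 c1 : R -> plane) : Prop :=
  exists H : R * R -> plane,
    [/\ {within `[0, 1] `*` setT, continuous H},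
        forall s t, s \in `[0, 1] -> ~ lattice (H (s, t)),
        forall s, s \in `[0, 1] ->
          exists2 g, Gamma g & forall t, H (s, t + 1) = g (H (s, t)),
        forall t, H (0, t) = c0 t
      & exists2 g, Gamma g & forall t, H (1, t) = g (c1 t)].

Definition no_self_intersection (c : R -> plane) : Prop :=
  forall s t, same_orbit (c s) (c t) -> s - t \is a Num.int.

(* c bounds an embedded closed disk of the sphere R^2 / Gamma whose center is
   the class of p and which avoids the classes of Z^2 except possibly at its
   center: f gives the disk in polar coordinates (radius, angle), with angles
   in R/Z, and is lifted to R^2. *)
Definition bounds_disk_centered_at (p : plane) (c : R -> plane) : Prop :=
  exists f : R * R -> plane,
    [/\ {within `[0, 1] `*` setT, continuous f},
        forall t, f (0, t) = p /\ f (1, t) = c t,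
        forall r t, r \in `]0, 1] -> ~ lattice (f (r, t)),
        forall r, r \in `[0, 1] ->
          exists2 g, Gamma g & forall t, f (r, t + 1) = g (f (r, t))
      & forall r t r' t', r \in `]0, 1] -> r' \in `[0, 1] ->
          same_orbit (f (r, t)) (f (r', t')) ->
          r = r' /\ t - t' \is a Num.int].

Definition bounds_disk (c : R -> plane) : Prop :=
  exists2 p, ~ lattice p & bounds_disk_centered_at p c.

Definition bounds_punctured_disk (c : R -> plane) : Prop :=
  exists2 p, lattice p & bounds_disk_centered_at p c.

Definition simple_closed_curve (c : R -> plane) : Prop :=
  closed_curve c /\
  exists d, [/\ closed_curve d, free_homotopic c d, no_self_intersection d,
                ~ bounds_disk d & ~ bounds_punctured_disk d].

Definition curve_class (c : R -> plane) : set (R -> plane) :=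
  [set d | closed_curve d /\
           (free_homotopic c d \/ free_homotopic (rev_curve c) d)].

(* This is the set S(S_{0,4}). *)
Definition simple_classes : set (set (R -> plane)) :=
  [set C | exists2 c, simple_closed_curve c & C = curve_class c].

(* None is the slope oo. *)
Definition slope_dir (s : option rat) : int * int :=
  if s is Some q then (denq q, numq q) else (0, 1).

(* slope_dir s is a primitive integer vector, so that the smallest translation
   in Gamma preserving a line of slope s is by twice that vector: this runs
   exactly once along the closed curve image of the line. *)
Definition line_curve (x : plane) (s : option rat) : R -> plane :=
  fun t => (x.1 + t * (2 * (slope_dir s).1)%:~R,
            x.2 + t * (2 * (slope_dir s).2)%:~R).

Definition has_slope (C : set (R -> plane)) (s : option rat) : Prop :=
  exists2 x, forall t, ~ lattice (line_curve x s t) & C (line_curve x s).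

Definition even_int : set R := [set y | exists k : int, y = (2 * k)%:~R].

Definition cut_lines : set plane :=
  [set x | [\/ even_int x.2, even_int x.1 | even_int (x.1 + x.2)]].

(* The three open segments that fix the transverse orientations: every segment
   cut out by Z^2 on the lines above is a Gamma-translate of exactly one of
   them.  Crossing the segment of x with orient_form x increasing reads x. *)
Definition base_segment (x : gen) : set plane :=
  match x with
  | ga => [set p | 0 < p.1 < 1 /\ p.2 = 0]
  | gb => [set p | p.1 = 0 /\ 0 < p.2 < 1]
  | gc => [set p | 0 < p.1 < 1 /\ p.1 + p.2 = 2]
  end.

Definition orient_form (x : gen) (p : plane) : R :=
  match x with
  | ga => p.2
  | gb => - p.1
  | gc => p.1 + p.2 - 2
  end.

Definition crosses_at (c : R -> plane) (t : R) (x : letter) : Prop :=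
  exists2 g, Gamma g &
    let h (s : R) := (-1) ^+ x.2 * orient_form x.1 (g (c s)) in
    [/\ base_segment x.1 (g (c t)),
        \forall s \near t^'-, h s < 0
      & \forall s \near t^'+, 0 < h s].

Definition crossing_word (c : R -> plane) (u : word) : Prop :=
  exists ts : seq R,
    [/\ sorted <%R ts, size ts = size u,
        forall t, t \in ts <-> 0 <= t < 1 /\ cut_lines (c t)
      & forall k, (k < size u)%N ->
          crosses_at c (nth 0 ts k) (nth (ga, false) u k)].

(* u is a cyclically reduced word representing the class C.  Orientation and
   base point being free, u is determined by C up to cyclic permutation and
   inversion. *)
Definition represents (u : word) (C : set (R -> plane)) : Prop :=
  cyc_reduced u /\ exists2 c, C c & crossing_word c u.

Fixpoint cf (n : seq int) : rat :=
  match n with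
  | [::] => 0
  | [:: m] => m%:~R
  | m :: n' => m%:~R + (cf n')^-1
  end.

Definition cf_expansion (n : seq int) : Prop :=
  [/\ (0 < size n)%N,
      forall j, (0 < j < size n)%N -> 1 <= nth 0 n j
    & (2 <= size n)%N -> 2 <= last 0 n].

Definition special_slope (n : seq int) (i : nat) : rat :=
  if i is _.+1 then cf (take i n) else 0.

Definition special_slope' (n : seq int) (i : nat) : rat :=
  if i is j.+1 then cf (rcons (take j n) (nth 0 n j + 1)) else 1.

Definition half_length (s : rat) (l : rat) : Prop :=
  exists (C : set (R -> plane)) (u : word),
    [/\ simple_classes C, has_slope C (Some s), represents u C
      & l = (size u)%:R / 2].

Definition special_length (n : seq int) (i : nat) (l : rat) : Prop :=
  half_length (special_slope n i) l.

Definition special_length' (n : seq int) (i : nat) (l : rat) : Prop :=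
  half_length (special_slope' n i) l.

End FourPuncturedSphere.

(* Main.v *)
(* Each curve is given a holonomy in F_3, the product of the letters that it
   crosses, read off finely sampled points; it depends, up to conjugacy, only on
   the free homotopy class, and two conjugate cyclically reduced words are cyclic
   permutations of each other. So gamma is, up to rotation and inversion, the
   word of a straight line, which is computed explicitly: in coordinates where
   the direction is (X, l - X) with l the half-length, the letter at position j
   depends only on the integers floor (X i / l) for i = j - 1, j, j + 1.

   The directions of gamma_i and gamma'_i form a basis of Z^2 in which the one of
   gamma has positive coordinates A, B. Cutting Z^2 into rows parallel to gamma_i
   splits the line of gamma into overlapping strips, on each of which the floors
   are those of a line parallel to gamma_i. Each strip reads a known set of
   blocks of length l_i - 3 (up to even translations and point reflections, which
   give equal or inverse words), and at most three consecutive strips contain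
   all of them. Hence w or its inverse occurs in every window of
   5 l_i + l'_i - 10 <= 15 |w| letters of W. *)
Require Import Defs.
From HB Require Import structures.
From mathcomp Require Import all_boot all_order all_algebra.
From mathcomp Require Import all_classical all_reals all_analysis.
From mathcomp Require Import zify ring lra.
Import Order.TTheory GRing.Theory Num.Theory.
Import numFieldNormedType.Exports.
Set Implicit Arguments.
Unset Strict Implicit.
Unset Printing Implicit Defensive.
Local Open Scope classical_set_scope.
Local Open Scope ring_scope.

(** * The free group *)

(** A curve in a homotopy may touch a cutting line, follow it or turn back on it, so its crossings
    cannot be listed. The levels are therefore defined at every point off the lattice, by a
    half-open convention compatible with [Gamma]: sampled points always have transitions in the free
    group, with no general position. What is obtained is known up to conjugacy and inversion, for
    all sufficiently fine samplings.

    The lower bound on |W| acts twice. It excludes gamma = gamma_i, whose word has only 2 l_i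
    letters, so that B > 0, while n_r >= 2 gives A > 0. It also makes W at least one window long, so
    that cutting W greedily into windows loses less than a factor 2: hence 30 = 2 * 15. The block
    length l_i - 3 is |w| + 2, because a letter also sees the heights at its two neighbours. The
    case i = 0 is void, as l_0 = 1. *)

Definition no_cancel (x y : letter) : bool := y != linv x.

Definition reduced : pred word := sorted no_cancel.

Definition push (x : letter) (u : word) : word :=
  if u is y :: u' then if y == linv x then u' else x :: u else [:: x].

Definition red (u : word) : word := foldr push [::] u.

Lemma linvK : involutive linv.
Proof. by case=> x b; rewrite /linv /= negbK. Qed.

Lemma winvK : involutive winv.
Proof.
move=> u; rewrite /winv map_rev revK -map_comp map_id_in // => x _ /=.
exact: linvK.
Qed.

Lemma winv_cat u v : winv (u ++ v) = winv v ++ winv u.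
Proof. by rewrite /winv map_cat rev_cat. Qed.

Lemma winv_cons x u : winv (x :: u) = rcons (winv u) (linv x).
Proof. by rewrite /winv /= rev_cons. Qed.

Lemma size_winv u : size (winv u) = size u.
Proof. by rewrite size_rev size_map. Qed.

Lemma no_cancel_linv x y : no_cancel (linv y) (linv x) = no_cancel x y.
Proof.
rewrite /no_cancel linvK; congr (~~ _).
by apply/eqP/eqP => [->|->]; rewrite ?linvK.
Qed.

Lemma reduced_winv u : reduced (winv u) = reduced u.
Proof.
rewrite /reduced /winv rev_sorted sorted_map.
by apply: eq_sorted => x y /=; apply: no_cancel_linv.
Qed.

Lemma push_reduced x u : reduced u -> reduced (push x u).
Proof.
case: u => [|y u] //= ru; case: (eqVneq y (linv x)) => [_|yx /=].
  by move: ru; apply: path_sorted.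
by rewrite /no_cancel yx.
Qed.

Lemma foldr_push_reduced w u : reduced w -> reduced (foldr push w u).
Proof. by move=> rw; elim: u => //= x u; apply: push_reduced. Qed.

Lemma red_reduced u : reduced (red u).
Proof. exact: foldr_push_reduced. Qed.

Lemma red_id u : reduced u -> red u = u.
Proof.
elim: u => //= x u IH pxu; rewrite IH; last exact: path_sorted pxu.
by case: u pxu {IH} => //= y u /andP[/negPf->].
Qed.

(** Van der Waerden's trick: each letter acts bijectively on reduced words, its inverse letter
    acting as the inverse. Associativity of the group law follows without a confluence argument for
    cancellations. *)
Lemma pushK x u : reduced u -> push x (push (linv x) u) = u.
Proof.
case: u => [_|y u /= ru] /=; first by rewrite eqxx.
rewrite linvK; case: eqVneq => [yx|yx] /=; last by rewrite eqxx.
subst y; case: u ru => [|z u] //=.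
by rewrite {1}/no_cancel; case: eqVneq.
Qed.

Lemma foldr_push_red w u : reduced w -> foldr push w (red u) = foldr push w u.
Proof.
move=> rw.
have E x r : foldr push w (push x r) = push x (foldr push w r).
  case: r => [|y r] //=; case: eqVneq => [->|//].
  by rewrite pushK //; apply: foldr_push_reduced.
by elim: u => //= x u IH; rewrite E IH.
Qed.

Lemma red_catl u v : red (red u ++ v) = red (u ++ v).
Proof. by rewrite /red !foldr_cat foldr_push_red //; apply: red_reduced. Qed.

Lemma red_catr u v : red (u ++ red v) = red (u ++ v).
Proof. by rewrite /red !foldr_cat -/(red v) -/(red (red v)) red_id ?red_reduced. Qed.

Lemma red_winv_cat u : red (winv u ++ u) = [::].
Proof.
elim: u => //= x u IH; rewrite winv_cons cat_rcons.
rewrite -red_catr /= -/(red u) -{2}[x]linvK pushK ?red_reduced //.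
by rewrite red_catr.
Qed.

Lemma reduced_cat s x y t : reduced (rcons s x ++ y :: t) =
  [&& reduced (rcons s x), no_cancel x y & reduced (y :: t)].
Proof. by case: s => [|z s] /=; rewrite ?cat_path ?last_rcons. Qed.

Record F3 := FreeGroupElt { F3_val : word; F3_valP : reduced F3_val }.

Lemma F3_val_inj : injective F3_val.
Proof.
case=> u ru [v rv] /= uv; subst v.
by rewrite (bool_irrelevance ru rv).
Qed.

Definition F3_of (u : word) : F3 := FreeGroupElt (red_reduced u).

HB.instance Definition _ := gen_eqMixin F3.
HB.instance Definition _ := gen_choiceMixin F3.

Definition F3_mul (g h : F3) : F3 := F3_of (F3_val g ++ F3_val h).
Definition F3_inv (g : F3) : F3 := F3_of (winv (F3_val g)).

Lemma F3_ofK g : F3_of (F3_val g) = g.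
Proof. by apply: F3_val_inj => /=; apply/red_id/F3_valP. Qed.

Lemma F3_mulE u v : F3_mul (F3_of u) (F3_of v) = F3_of (u ++ v).
Proof. by apply: F3_val_inj; rewrite /= red_catr red_catl. Qed.

Lemma F3_mulA : associative F3_mul.
Proof.
move=> x y z; rewrite -(F3_ofK x) -(F3_ofK y) -(F3_ofK z).
by rewrite !F3_mulE catA.
Qed.

Lemma F3_mul1 : left_id (F3_of [::]) F3_mul.
Proof. by move=> x; rewrite -(F3_ofK x) F3_mulE. Qed.

Lemma F3_mulr1 : right_id (F3_of [::]) F3_mul.
Proof. by move=> x; rewrite -(F3_ofK x) F3_mulE cats0. Qed.

Lemma F3_mulV : left_inverse (F3_of [::]) F3_inv F3_mul.
Proof.
move=> x; rewrite -{2}(F3_ofK x) F3_mulE.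
by apply: F3_val_inj; rewrite /= red_winv_cat.
Qed.

Lemma F3_mulrV : right_inverse (F3_of [::]) F3_inv F3_mul.
Proof.
move=> x; rewrite -{1}(F3_ofK x) F3_mulE.
by apply: F3_val_inj; rewrite /= -{1}(winvK (F3_val x)) red_winv_cat.
Qed.

HB.instance Definition _ :=
  isGroup.Build F3 F3_mulA F3_mul1 F3_mulr1 F3_mulV F3_mulrV.

Local Open Scope group_scope.

Lemma F3_of_nil : F3_of [::] = 1.
Proof. by []. Qed.

Lemma F3_of_cat u v : F3_of (u ++ v) = F3_of u * F3_of v.
Proof. by rewrite -F3_mulE. Qed.

Lemma F3_of_winv u : F3_of (winv u) = (F3_of u)^-1.
Proof.
apply: (mulIg (F3_of u)); rewrite mulVg -F3_of_cat.
by apply: F3_val_inj; rewrite /= red_winv_cat.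
Qed.

(** * Conjugacy and cyclic permutations *)

Definition F3_conj (x y : F3) : Prop := exists g, x * g = g * y.

Lemma F3_conj_refl x : F3_conj x x.
Proof. by exists 1; rewrite mulg1 mul1g. Qed.

Lemma F3_conj_sym x y : F3_conj x y -> F3_conj y x.
Proof.
case=> g xg; exists g^-1; apply: (mulgI g); rewrite mulgA -xg -mulgA mulgV.
by rewrite mulg1 mulgA mulgV mul1g.
Qed.

Lemma F3_conj_trans y x z : F3_conj x y -> F3_conj y z -> F3_conj x z.
Proof. by case=> g xg [h yh]; exists (g * h); rewrite mulgA xg -mulgA yh mulgA. Qed.

Lemma F3_conj_inv x y : F3_conj x y -> F3_conj x^-1 y^-1.
Proof.
case=> g xg; exists g; apply: (mulgI x); rewrite mulgA mulgV mul1g.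
by rewrite mulgA xg -mulgA mulgV mulg1.
Qed.

Lemma cyc_reduced_rot k u : cyc_reduced (rot k u) = cyc_reduced u.
Proof. exact: rot_cycle. Qed.

Lemma cyc_reduced_reduced u : cyc_reduced u -> reduced u.
Proof. by case: u => //= x u; rewrite rcons_path => /andP[]. Qed.

Definition is_rot (u v : word) : Prop := exists k, v = rot k u.

Lemma is_rot_trans v u w : is_rot u v -> is_rot v w -> is_rot u w.
Proof. by case=> i -> [j ->]; rewrite rot_rot_add; eexists. Qed.

Lemma is_rot_sym u v : is_rot u v -> is_rot v u.
Proof. by case=> k ->; rewrite rot_minn; exists (size u - minn k (size u))%N; rewrite -{1}(size_rot (minn k (size u)) u) -/(rotr _ _) rotK. Qed.

Lemma is_rot_cat u1 u2 : is_rot (u1 ++ u2) (u2 ++ u1).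
Proof. by exists (size u1); rewrite rot_size_cat. Qed.

(* A shortest conjugator neither starts with the first letter of u nor with the
   inverse of its last one, so that g^-1 u g has no cancellation at all; but
   then it is not cyclically reduced unless g = 1. *)
Lemma F3_conj_cyc_reduced u v :
  cyc_reduced u -> cyc_reduced v -> F3_conj (F3_of u) (F3_of v) -> is_rot u v.
Proof.
move=> cu cv [g]; rewrite -(F3_ofK g); case: g => g rg /=.
have [n] := ubnP (size g); elim: n u g cu rg => // n IH u [|x g] cu rg gn E.
  exists 0%N; rewrite rot0; move: E; rewrite F3_of_nil mulg1 mul1g => -[] /=.
  by rewrite !red_id ?cyc_reduced_reduced.
have rg' : reduced g by apply: path_sorted rg.
have Ex : F3_of (x :: g) = F3_of [:: x] * F3_of g by rewrite -F3_of_cat.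
have step u1 u2 : u = u1 ++ u2 ->
    F3_of (u2 ++ u1) * F3_of g = F3_of g * F3_of v -> is_rot u v.
  move=> uE E1; rewrite uE; apply: is_rot_trans (is_rot_cat _ _) _.
  apply: IH E1 => //; rewrite -(rot_size_cat u1 u2) -uE.
  by rewrite cyc_reduced_rot.
case: (altP (u =P [::])) => [u0|].
  exists 0%N; rewrite rot0; move: E; rewrite u0 F3_of_nil mul1g.
  rewrite -{1}[F3_of (x :: g)]mulg1 => /mulgI [] /=.
  by rewrite red_id ?cyc_reduced_reduced.
case/lastP: u cu E step => // u y cu E step _.
case: (eqVneq y (linv x)) => [yx|yx].
  apply: (step u [:: y]); rewrite ?cats1 //= -cat1s F3_of_cat yx.
  move: E; rewrite -cats1 F3_of_cat Ex yx -[[:: linv x]]/(winv [:: x]) !F3_of_winv.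
  rewrite -(mulgA (F3_of u)) mulKg => E; rewrite -[LHS]mulgA E.
  by rewrite -[X in _ * X]mulgA mulKg.
case: (eqVneq (head y u) x) => [ux|ux].
  case: u ux cu E step {yx} => [|z u] /= zx cu E step.
    apply: (step [:: y] [::]) => //=; move: E; rewrite zx Ex.
    by rewrite -[X in _ = X]mulgA => /mulgI.
  apply: (step [:: x] (rcons u y)); first by rewrite zx.
  move: E; rewrite Ex zx -cat1s F3_of_cat -[X in X = _]mulgA -[X in _ = X]mulgA.
  by move/mulgI; rewrite mulgA F3_of_cat.
have rU : reduced (winv (x :: g) ++ rcons u y ++ x :: g).
  have uE : rcons u y = head y u :: behead (rcons u y) by case: (u).
  rewrite winv_cons {1}uE reduced_cat -cat_cons -uE reduced_cat -winv_cons.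
  rewrite reduced_winv rg (cyc_reduced_reduced cu) /no_cancel linvK ux.
  by rewrite -(inj_eq (can_inj linvK)) linvK eq_sym yx.
have vE : v = winv (x :: g) ++ rcons u y ++ x :: g.
  rewrite -[LHS]red_id ?cyc_reduced_reduced // -[RHS]red_id //.
  suff [] : F3_of v = F3_of (winv (x :: g) ++ rcons u y ++ x :: g) by [].
  apply: (mulgI (F3_of (x :: g))).
  by rewrite -[LHS]E !F3_of_cat F3_of_winv mulVKg.
move: cv; rewrite vE.
have [z [s gE]] : exists z s, x :: g = rcons s z.
  by exists (last x g), (belast x g); rewrite lastI.
rewrite gE /winv map_rcons rev_rcons /= rcons_path -!rcons_cat last_rcons.
by rewrite eqxx andbF.
Qed.

Local Close Scope group_scope.

(** * Positions with respect to the cutting lines *)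

Definition nxt (x : gen) : gen := match x with ga => gb | gb => gc | gc => ga end.

Definition oddz (n : int) : bool := (n %% 2)%Z == 1.

Lemma oddz2 n k : oddz (n + 2 * k) = oddz n.
Proof. by rewrite /oddz; lia. Qed.

Lemma oddzN1 n : oddz (- n - 1) = ~~ oddz n.
Proof. by rewrite /oddz; lia. Qed.

Lemma int_pred_cmp (k : int) : [/\ (k < k - 1) = false, k - 1 < k & (k - 1 == k) = false].
Proof. by split; lia. Qed.

Lemma int_near_cases (n k : int) : -1 < n - k + 1 < 2 -> n = k \/ n = k - 1.
Proof. lia. Qed.

Section Levels.
Variable R : realType.
Implicit Types (p q : plane R) (x y : gen).

(* The crossings read x or x^-1 are the passages of the form of x through an
   even value. The symmetry (x, y) |-> (y, - x - y) of order three permutes the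
   three forms; thanks to it the generators are treated alike. *)
Definition lform x p : R :=
  match x with ga => p.2 | gb => p.1 | gc => - (p.1 + p.2) end.

Definition side x p : int := Num.floor (lform (nxt x) p).

(* Half-open convention for the position of p among the lines of x, chosen
   opposite on the two kinds of segments so that it is Gamma-equivariant. *)
Definition lev x p : int :=
  if oddz (side x p) then Num.floor (lform x p / 2) else Num.ceil (lform x p / 2) - 1.

Lemma lform_sum x p : lform x p + lform (nxt x) p + lform (nxt (nxt x)) p = 0.
Proof. by case: x => /=; lra. Qed.

Lemma lev_odd x p n : oddz (side x p) ->
  2 * n%:~R <= lform x p < 2 * n%:~R + 2 -> lev x p = n.
Proof.
by move=> o /andP[h1 h2]; rewrite /lev o; apply: floor_def; rewrite intrD; lra.
Qed.

Lemma lev_even x p n : oddz (side x p) = false ->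
  2 * n%:~R < lform x p <= 2 * n%:~R + 2 -> lev x p = n.
Proof.
move=> o /andP[h1 h2]; rewrite /lev o.
suff -> : Num.ceil (lform x p / 2) = n + 1 by lia.
by apply: ceil_def; rewrite addrK intrD; lra.
Qed.

Lemma lev_generic x p n : 2 * n%:~R < lform x p < 2 * n%:~R + 2 -> lev x p = n.
Proof.
move=> /andP[h1 h2]; case o : (oddz (side x p)); [apply: lev_odd | apply: lev_even] => //; lra.
Qed.

Definition even_at x p := exists k : int, lform x p = 2 * k%:~R.

Lemma not_even_itv x p : ~ even_at x p ->
  2 * (Num.floor (lform x p / 2))%:~R < lform x p < 2 * (Num.floor (lform x p / 2))%:~R + 2.
Proof.
move=> ne; have := floor_itv (lform x p / 2); rewrite intrD => /andP[h1 h2].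
rewrite lt_neqAle; apply/andP; split; [apply/andP; split|]; [|lra|lra].
by apply/eqP => h; apply: ne; exists (Num.floor (lform x p / 2)).
Qed.

(** The three forms sum to zero, so two integral ones force the third. Hence a point off the lattice
    lies on at most one cutting line, and there the form of [nxt x] is not an integer. *)
Lemma lattice_lform x y p : x <> y ->
  lform x p \is a Num.int -> lform y p \is a Num.int -> lattice p.
Proof.
have E (u v : R) : u \is a Num.int -> - (u + v) \is a Num.int -> v \is a Num.int.
  by move=> hu; rewrite rpredN rpredDl.
have E' (u v : R) : v \is a Num.int -> - (u + v) \is a Num.int -> u \is a Num.int.
  by move=> hu; rewrite rpredN rpredDr.
rewrite /lattice /=; case: x; case: y => //= _ h1 h2; split; try done;
 by first [apply: E h1 h2 | apply: E' h1 h2 | apply: E h2 h1 | apply: E' h2 h1].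
Qed.

Lemma even_at_int x p : even_at x p -> lform x p \is a Num.int.
Proof. by case=> k ->; rewrite rpredM ?intr_int // (_ : 2 = 2%:~R) ?intr_int. Qed.

Lemma not_lattice_side x p : ~ lattice p -> even_at x p -> lform (nxt x) p \isn't a Num.int.
Proof.
move=> np /even_at_int ex; apply/negP => hn; apply: np.
by apply: (lattice_lform _ ex hn); case: x {ex hn}.
Qed.

Lemma not_lattice_even x y p : ~ lattice p -> x <> y -> even_at x p -> ~ even_at y p.
Proof.
move=> np xy /even_at_int ex /even_at_int ey.
by apply: np; apply: (lattice_lform xy ex ey).
Qed.

Lemma Gamma_lform (g : plane R -> plane R) : Gamma g ->
  exists (e : bool) (k : gen -> int), forall x p,
    lform x (g p) = (if e then - lform x p else lform x p) + 2 * (k x)%:~R.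
Proof.
case=> e [m [n gE]]; exists e, (fun x => match x with ga => n | gb => m | gc => - (m + n) end).
by move=> x p; rewrite gE; case: x; case: e {gE} => /=; rewrite ?(intrM, intrN, intrD, rmorphN, rmorphD) /=; lra.
Qed.

Lemma side_Gamma (g : plane R -> plane R) e (k : gen -> int) x p :
  (forall x p, lform x (g p) = (if e then - lform x p else lform x p) + 2 * (k x)%:~R) ->
  e ==> (lform (nxt x) p \isn't a Num.int) ->
  oddz (side x (g p)) = e (+) oddz (side x p).
Proof.
move=> gE he; rewrite /side gE.
have h := floor_itv (lform (nxt x) p); rewrite intrD in h.
case: e he {gE} => /= [ni|_].
  suff -> : Num.floor (- lform (nxt x) p + 2 * (k (nxt x))%:~R) =
    (- Num.floor (lform (nxt x) p) - 1) + 2 * k (nxt x) by rewrite oddz2 oddzN1.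
  apply: floor_def; rewrite !(intrD, intrN, intrM).
  have : (Num.floor (lform (nxt x) p))%:~R != lform (nxt x) p.
    by apply: contraNneq ni => <-; apply: intr_int.
  by rewrite neq_lt; lra.
suff -> : Num.floor (lform (nxt x) p + 2 * (k (nxt x))%:~R) =
    Num.floor (lform (nxt x) p) + 2 * k (nxt x) by rewrite oddz2.
by apply: floor_def; rewrite !(intrD, intrN, intrM); lra.
Qed.

Lemma lev_itv x p :
  if oddz (side x p) then 2 * (lev x p)%:~R <= lform x p < 2 * (lev x p)%:~R + 2
  else 2 * (lev x p)%:~R < lform x p <= 2 * (lev x p)%:~R + 2.
Proof.
rewrite /lev; case: (oddz (side x p)).
  by have /andP[] := floor_itv (lform x p / 2); rewrite intrD; lra.
by have /andP[] := ceil_itv (lform x p / 2); rewrite !(intrD, intrN); lra.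
Qed.

(** A point reflection turns intervals closed on the left into intervals closed on the right, but it
    also flips the parity of [side], which switches the convention. Off the lattice this flip is
    guaranteed on the lines of [x]; elsewhere both conventions agree. *)
Lemma lev_Gamma (g : plane R -> plane R) e (k : gen -> int) x p :
  (forall x p, lform x (g p) = (if e then - lform x p else lform x p) + 2 * (k x)%:~R) ->
  ~ lattice p -> lev x (g p) = (if e then - lev x p - 1 else lev x p) + k x.
Proof.
move=> gE np; have gx := gE x p.
have [ev|nev] := pselect (even_at x p).
  have sE : oddz (side x (g p)) = e (+) oddz (side x p).
    by apply: side_Gamma gE _; rewrite not_lattice_side ?implybT.
  have := lev_itv x p.
  case: e gE gx sE => _ gx sE; case o: (oddz (side x p)) sE => /= sE h;
    first [by apply: lev_odd; rewrite ?sE //= gx !(intrD, intrN); lra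
          |by apply: lev_even; rewrite ?sE //= gx !(intrD, intrN); lra].
have h := not_even_itv nev; rewrite (lev_generic h).
by apply: lev_generic; rewrite gx; case: (e); rewrite !(intrD, intrN); lra.
Qed.

Definition trans1 x p q : F3 :=
  if lev x p < lev x q then F3_of [:: (x, oddz (side x p))]
  else if lev x q < lev x p then F3_of [:: (x, ~~ oddz (side x p))] else 1%g.

(** Only meant for nearby points off the lattice, where at most one factor is nontrivial; the order
    of the factors is then immaterial. *)
Definition trans p q : F3 := (trans1 ga p q * trans1 gb p q * trans1 gc p q)%g.

Lemma trans1_eq x p q : lev x p = lev x q -> trans1 x p q = 1%g.
Proof. by rewrite /trans1 => ->; rewrite ltxx. Qed.

Lemma trans_single x p q : (forall y, y <> x -> lev y p = lev y q) ->
  trans p q = trans1 x p q.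
Proof.
move=> h; rewrite /trans; have E y : y <> x -> trans1 y p q = 1%g.
  by move=> yx; apply/trans1_eq/h.
case: x E {h} => E.
- by rewrite (E gb) // (E gc) // !mulg1.
- by rewrite (E ga) // (E gc) // mulg1 mul1g.
- by rewrite (E ga) // (E gb) // !mul1g.
Qed.

Lemma lform_continuous x : continuous (lform x).
Proof.
case: x => p /=; [exact: cvg_snd | exact: cvg_fst |].
by apply: cvgN; apply: cvgD; [exact: cvg_fst | exact: cvg_snd].
Qed.

Lemma lform_near x p0 (a b : R) : a < lform x p0 < b ->
  \forall p \near p0, a < lform x p < b.
Proof.
move=> /andP[h1 h2].
have c : lform x p @[p --> p0] --> lform x p0 by exact: lform_continuous.
have F1 := cvgr_gt _ c _ h1; have F2 := cvgr_lt _ c _ h2.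
by near=> p; apply/andP; split; near: p; [exact: F1 | exact: F2].
Unshelve. all: by end_near.
Qed.

Lemma lev_near x p0 : ~ even_at x p0 -> \forall p \near p0, lev x p = lev x p0.
Proof.
move=> ne; have h := not_even_itv ne; rewrite (lev_generic h).
by near=> p; apply: lev_generic; near: p; apply: lform_near.
Unshelve. all: by end_near. Qed.

Lemma side_near x p0 : lform (nxt x) p0 \isn't a Num.int ->
  \forall p \near p0, side x p = side x p0 /\ lform (nxt x) p \isn't a Num.int.
Proof.
move=> ni; have := floor_itv (lform (nxt x) p0); set n := Num.floor _ => h.
have h' : n%:~R < lform (nxt x) p0 < (n + 1)%:~R.
  rewrite lt_neqAle; case/andP: h => -> ->; rewrite !andbT.
  by apply: contraNneq ni => <-; apply: intr_int.
near=> p.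
have /andP[h1 h2] : n%:~R < lform (nxt x) p < (n + 1)%:~R.
  by near: p; apply: lform_near.
split; first by rewrite /side -/n; apply: floor_def; rewrite ltW.
apply/negP => /intrP[m mE]; move: h1 h2; rewrite mE !ltr_int; lia.
Unshelve. all: by end_near. Qed.

(** [phi] is a local potential: transitions telescope inside [U] and cancel around small loops.
    Invariance under [Gamma] makes them independent of the lift. *)
Definition trans_good (U : set (plane R)) :=
  exists phi : plane R -> F3, forall p q, U p -> U q -> ~ lattice p -> ~ lattice q ->
    trans p q = ((phi p)^-1 * phi q)%g /\
    forall g, Gamma g -> trans (g p) (g q) = trans p q.

(* Near a point off the lattice at most one of the three levels varies, and it
   takes only two values. *)
Lemma trans_local p0 : ~ lattice p0 -> exists2 U, nbhs p0 U & trans_good U.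
Proof.
move=> np; have [[x ex]|ne] := pselect (exists x, even_at x p0); last first.
  exists [set p | forall x, lev x p = lev x p0].
    have H x : \forall p \near p0, lev x p = lev x p0.
      by apply: lev_near => ex; apply: ne; exists x.
    near=> p => x; case: x; near: p; apply: H.
  exists (fun=> 1%g) => p q Up Uq pl ql; rewrite invg1 mulg1.
  have t1 p' q' : (forall x, lev x p' = lev x q') -> trans p' q' = 1%g.
    by move=> h; rewrite (@trans_single ga) ?trans1_eq.
  have lE x : lev x p = lev x q by rewrite Up Uq.
  rewrite t1 //; split=> // g /Gamma_lform[e [k gE]].
  by rewrite t1 // => x; rewrite !(lev_Gamma _ gE) // lE.
have ni := not_lattice_side np ex; case: (ex) => k kE.
exists [set p | [/\ side x p = side x p0 /\ lform (nxt x) p \isn't a Num.int,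
   2 * k%:~R - 2 < lform x p < 2 * k%:~R + 2 & forall y, y <> x -> lev y p = lev y p0]].
  have H y : \forall p \near p0, y <> x -> lev y p = lev y p0.
    have [->|yx] := pselect (y = x); first by near=> p.
    have := lev_near (not_lattice_even np (fun e => yx (esym e)) ex).
    by apply: filterS => p + _.
  near=> p; split.
  - by near: p; apply: side_near.
  - by near: p; apply: lform_near; rewrite kE; lra.
  - by case; near: p; apply: H.
(* The potential tells whether the line has been passed; since [side] is constant on this
   neighbourhood, one letter serves for all its points. *)
exists (fun p => if lev x p == k then F3_of [:: (x, oddz (side x p0))] else 1%g).
move=> p q [[sp nip] fp lp] [[sq niq] fq lq] pl ql.
have lk r : 2 * k%:~R - 2 < lform x r < 2 * k%:~R + 2 -> lev x r = k \/ lev x r = k - 1.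
  move=> /andP[h1 h2]; have := lev_itv x r => hl.
  apply: int_near_cases; rewrite -!(ltr_int R) !(intrD, intrN).
  by case: (oddz _) hl => /andP[h3 h4]; lra.
have lE y : y <> x -> lev y p = lev y q by move=> yx; rewrite lp ?lq.
split.
  rewrite (trans_single lE) /trans1 sp.
  have F b : F3_of [:: (x, ~~ b)] = (F3_of [:: (x, b)])^-1%g by rewrite -F3_of_winv.
  have [k1 k2 k3] := int_pred_cmp k.
  case: (lk p fp) => ->; case: (lk q fq) => ->.
  - by rewrite eqxx ltxx mulVg.
  - by rewrite eqxx k1 k2 k3 F mulg1.
  - by rewrite eqxx k2 k3 invg1 mul1g.
  - by rewrite ltxx k3 invg1 mulg1.
move=> g /Gamma_lform[e [m gE]].
rewrite (trans_single lE) (@trans_single x); last first.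
  by move=> y yx; rewrite !(lev_Gamma _ gE) // lE.
rewrite /trans1 (side_Gamma gE) ?nip ?implybT // !(lev_Gamma _ gE) //.
case: e {gE} => /=; last by rewrite !ltrD2r.
rewrite !ltrD2r !ltrN2 negbK.
by case: ltgtP.
Unshelve. all: by end_near. Qed.

End Levels.

(** * Holonomy of closed curves *)

Section Holonomy.
Variable R : realType.
Implicit Types (c : R -> plane R) (z : R * R).

Lemma lebesgue_number (K : set (R * R)) (good : set (R * R) -> Prop) : compact K ->
  (forall z, K z -> exists2 B, nbhs z B & good B) ->
  \forall N \near \oo, forall z, K z -> exists2 B, good B &
    forall z', `|z.1 - z'.1| <= N.+1%:R^-1 -> `|z.2 - z'.2| <= N.+1%:R^-1 -> B z'.
Proof.
move=> /compact_near_coveringP cK cov.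
pose P (N : nat) z := exists2 B, good B &
    forall z', `|z.1 - z'.1| <= N.+1%:R^-1 -> `|z.2 - z'.2| <= N.+1%:R^-1 -> B z'.
apply: (cK nat \oo P) => z0 /cov[B B0 gB].
have /nbhs_ballP[e /= e0 eB] := B0.
have e20 : 0 < e / 2 by rewrite divr_gt0.
exists (ball z0 (e / 2), [set N : nat | N.+1%:R^-1 < e / 2]) => /=.
  split; first exact: nbhsx_ballx.
  exact: (near_infty_natSinv_lt (PosNum e20)).
move=> [z N] /= [zz0 Ne]; exists B => // z' h1 h2; apply: eB.
move: zz0; rewrite /ball /= /prod_ball /= -!ball_normE /= => -[k1 k2]; split.
  rewrite (splitr e); apply: le_lt_trans (ler_distD z.1 _ _) _.
  by rewrite ltrD // (le_lt_trans h1).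
rewrite (splitr e); apply: le_lt_trans (ler_distD z.2 _ _) _.
by rewrite ltrD // (le_lt_trans h2).
Qed.

Fixpoint path_trans (p : nat -> plane R) (n : nat) : F3 :=
  if n is m.+1 then (path_trans p m * trans (p m) (p m.+1))%g else 1%g.

(** Commuting squares between two rows of samples are pasted side by side: one step of a discrete
    homotopy. *)
Lemma path_trans_grid (p p' : nat -> plane R) n :
  (forall k, (k < n)%N -> (trans (p k) (p k.+1) * trans (p k.+1) (p' k.+1) =
     trans (p k) (p' k) * trans (p' k) (p' k.+1))%g) ->
  (path_trans p n * trans (p n) (p' n) = trans (p 0%N) (p' 0%N) * path_trans p' n)%g.
Proof.
elim: n => [|n IH] h /=; first by rewrite mul1g mulg1.
rewrite -mulgA h // mulgA IH ?mulgA // => k kn; apply: h; exact: ltnW.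
Qed.

Lemma eq_path_trans (p p' : nat -> plane R) n :
  (forall k, (k < n)%N -> trans (p k) (p k.+1) = trans (p' k) (p' k.+1)) ->
  path_trans p n = path_trans p' n.
Proof.
elim: n => [//|n IH] h /=; rewrite h // IH // => k kn; apply: h; exact: ltnW.
Qed.

(** Significant only for large [N]; statements about it are therefore eventual in [N], and several
    of them are combined at a common [N]. *)
Definition hol (N : nat) c : F3 := path_trans (fun k => c (k%:R / N.+1%:R)) N.+1.

Lemma Gamma_inv (g : plane R -> plane R) : Gamma g -> exists2 g', Gamma g' & forall p, g' (g p) = p.
Proof.
case=> e [m [n gE]].
exists (fun p : plane R => (if e then - p else p) +
  ((2 * (if e then m else - m))%:~R : R, (2 * (if e then n else - n))%:~R : R)).
  by exists e, (if e then m else - m), (if e then n else - n).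
move=> [x y]; rewrite gE; case: (e); congr (_, _) => /=; rewrite ?mulrN ?intrN; ring.
Qed.

Let strip : set (R * R) := `[0, 1] `*` setT.

Lemma lform_near_strip (H : R * R -> plane R) (s0 t : R) (x : gen) (e : R) :
  {within strip, continuous H} -> s0 \in `[0, 1] -> 0 < e ->
  \forall s \near s0, s \in `[0, 1] ->
    lform x (H (s0, t)) - e < lform x (H (s, t)) < lform x (H (s0, t)) + e.
Proof.
move=> Hc s01 e0.
have Hcz : H x @[x --> within strip (nbhs (s0, t))] --> H (s0, t).
  by move: Hc => /subspace_continuousP; apply.
have U0 : nbhs (H (s0, t)) [set p | lform x (H (s0, t)) - e < lform x p < lform x (H (s0, t)) + e].
  by apply: lform_near; lra.
have := Hcz _ U0; rewrite /= nbhs_simpl /within /= => /nbhs_ballP[d /= d0 dB].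
exists d => // s ss0 s1; apply: (dB (s, t)); last by split.
by split => //=; apply: ballxx.
Qed.

Lemma lform_inj (p q : plane R) : lform ga p = lform ga q -> lform gb p = lform gb q -> p = q.
Proof. by case: p q => [a b] [c d] /= -> ->. Qed.

Lemma int_lt1 (k l : int) : -1 < 2 * (k%:~R - l%:~R : R) < 1 -> k = l.
Proof.
have -> : 2 * (k%:~R - l%:~R : R) = (2 * (k - l))%:~R by rewrite !(intrD, intrN, intrM).
by rewrite (_ : -1 = (-1)%:~R) // (ltr_int R (-1)) (ltr_int R _ 1); lia.
Qed.

Lemma int_gap (m : int) (u : R) : u \isn't a Num.int ->
  Num.floor u = m -> 0 < (u - m%:~R) /\ u < m%:~R + 1.
Proof.
move=> ni mE; have := floor_itv u; rewrite mE intrD => /andP[h1 h2]; split; last by [].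
rewrite subr_gt0 lt_neqAle h1 andbT; apply: contraNneq ni => <-; exact: intr_int.
Qed.

(* This is where the freeness of the action of Gamma off the lattice is used. *)
Lemma deck_near (H : R * R -> plane R) (s0 : R) (g : plane R -> plane R) :
  {within strip, continuous H} -> s0 \in `[0, 1] -> ~ lattice (H (s0, 0)) ->
  (forall s, s \in `[0, 1] -> exists2 g, Gamma g & forall t, H (s, t + 1) = g (H (s, t))) ->
  Gamma g -> H (s0, 1) = g (H (s0, 0)) ->
  \forall s \near s0, s \in `[0, 1] -> H (s, 1) = g (H (s, 0)).
Proof.
move=> Hc s01 nl Hg /Gamma_lform[e0 [k0 gE]] H1.
have [x nx] : exists x, lform x (H (s0, 0)) \isn't a Num.int.
  apply: contrapT => h; apply: nl; apply: (@lattice_lform _ ga gb) => //.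
  - by apply: contrapT => /negP k; apply: h; exists ga.
  - by apply: contrapT => /negP k; apply: h; exists gb.
set u0 := lform x (H (s0, 0)) in nx.
have [g1 g2] := int_gap nx erefl; set m := Num.floor u0 in g1 g2.
(* A quarter of the distances from [u0] to the integers around it, which rules out a change of sign,
   and at most 1/4, which rules out a change of translation. *)
pose e := Num.min (Num.min ((u0 - m%:~R) / 4) ((m%:~R + 1 - u0) / 4)) (1 / 4).
have [ep e1 e2 e3] : [/\ 0 < e, e <= 1 / 4, e <= (u0 - m%:~R) / 4 & e <= (m%:~R + 1 - u0) / 4].
  rewrite /e; split; rewrite ?ge_min ?lexx ?orbT //.
  by rewrite !lt_min; apply/andP; split; [apply/andP; split|]; lra.
have near_st y t := lform_near_strip t y Hc s01 ep.
near=> s => s1.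
have N y t : (t = 0 \/ t = 1) ->
    lform y (H (s0, t)) - e < lform y (H (s, t)) < lform y (H (s0, t)) + e.
  by case: y => -[] ->; move: s1; near: s; apply: near_st.
have [h Gh hE] := Hg s s1; have [e' [k hF]] := Gamma_lform Gh.
have := hE 0; rewrite add0r => {}hE.
have F y : lform y (H (s, 1)) = (if e' then - lform y (H (s, 0)) else lform y (H (s, 0))) + 2 * (k y)%:~R.
  by rewrite hE hF.
have F0 y : lform y (H (s0, 1)) = (if e0 then - lform y (H (s0, 0)) else lform y (H (s0, 0))) + 2 * (k0 y)%:~R.
  by rewrite H1 gE.
(* With opposite signs, adding the two relations would put [u0] within [e] of the integer
   half-difference of the translations. *)
have ee : e' = e0.
  have := F x; have := F0 x; have := N x _ (or_introl erefl); have := N x _ (or_intror erefl).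
  rewrite -/u0; clear - e1 e2 e3 ep g1 g2; set v := lform x (H (s, 1)).
  have G (l : int) : u0 - e < l%:~R < u0 + e -> False.
    move=> /andP[h1 h2]; have : m%:~R < l%:~R :> R by lra.
    have : l%:~R < (m + 1)%:~R :> R by rewrite intrD; lra.
    by rewrite !ltr_int; lia.
  case: e' e0 => -[] // /andP[h1 h2] /andP[h3 h4] E0 E; exfalso.
    by apply: (G (k x - k0 x)); rewrite intrD intrN; lra.
  by apply: (G (k0 x - k x)); rewrite intrD intrN; lra.
have kk y : k y = k0 y.
  have := F y; have := F0 y; have := N y _ (or_introl erefl); have := N y _ (or_intror erefl).
  move=> /andP[h1 h2] /andP[h3 h4] E0 E; apply: int_lt1.
  by move: E E0; rewrite ee; case: (e0) => E E0; lra.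
by apply: lform_inj; rewrite gE F ee kk.
Unshelve. all: by end_near. Qed.

(** Besides good transitions on each cell, the mesh provides a deck transformation common to all
    parameters [s] of the cell; this is what closes the grid up into a cylinder. *)
Lemma homotopy_good (H : R * R -> plane R) :
  {within strip, continuous H} ->
  (forall s t, s \in `[0, 1] -> ~ lattice (H (s, t))) ->
  (forall s, s \in `[0, 1] -> exists2 g, Gamma g & forall t, H (s, t + 1) = g (H (s, t))) ->
  \forall N \near \oo, forall z, (`[0, 1] `*` `[0, 1])%classic z ->
    exists (U : set (plane R)) g, [/\ trans_good U, Gamma g &
      forall s t, s \in `[0, 1] -> `|z.1 - s| <= N.+1%:R^-1 -> `|z.2 - t| <= N.+1%:R^-1 ->
         U (H (s, t)) /\ H (s, 1) = g (H (s, 0))].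
Proof.
move=> Hc Hl Hg.
pose good (B : set (R * R)) := exists (U : set (plane R)) g, [/\ trans_good U, Gamma g &
      forall s t, s \in `[0, 1] -> B (s, t) ->
         U (H (s, t)) /\ H (s, 1) = g (H (s, 0))].
have cK : compact (`[0, 1] `*` `[0, 1] : set (R * R)).
  by apply: compact_setX; apply: segment_compact.
have /(lebesgue_number cK) : forall z, (`[0, 1] `*` `[0, 1])%classic z ->
    exists2 B, nbhs z B & good B; last first.
  apply: filterS => N h z /h[B [U [g [gU Gg UB]]] BB].
  by exists U, g; split=> // s t s1 h1 h2; apply: UB => //; apply: BB.
move=> [s0 t0] /= [s01 t01].
have [U U0 gU] := trans_local (Hl s0 t0 s01).
have [g Gg gE] := Hg _ s01.
have gE0 := gE 0; rewrite add0r in gE0.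
have D := deck_near Hc s01 (Hl s0 0 s01) Hg Gg gE0.
have Hcz : H x @[x --> within strip (nbhs (s0, t0))] --> H (s0, t0).
  by move: Hc => /subspace_continuousP; apply.
have := Hcz U U0; rewrite /= nbhs_simpl /within /= => W.
exists [set z | (strip z -> U (H z)) /\ (z.1 \in `[0, 1] -> H (z.1, 1) = g (H (z.1, 0)))].
  near=> z; split; near: z; first exact: W.
  move: D => /nbhs_ballP[d /= d0 dB].
  exists (ball s0 d, setT) => /=; first by split; [exact: nbhsx_ballx | exact: filterT].
  by move=> [a b] [/= h _]; apply: dB.
exists U, g; split => // s t s1 [/= h1 h2]; split; last exact: h2.
by apply: h1; split.
Unshelve. all: by end_near. Qed.

Lemma mesh_itv (i N : nat) : (i <= N.+1)%N -> (i%:R / N.+1%:R : R) \in `[0, 1].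
Proof.
by move=> iN; rewrite in_itv /= divr_ge0 ?ler0n //= ler_pdivrMr ?ltr0n // mul1r ler_nat.
Qed.

Lemma mesh_step (i N : nat) : `|i%:R / N.+1%:R - i.+1%:R / N.+1%:R| <= N.+1%:R^-1 :> R.
Proof.
by rewrite -mulrBl -natr1 opprD addNKr mulN1r normrN gtr0_norm // invr_gt0 ltr0n.
Qed.

Lemma mesh_same (x : R) N : `|x - x| <= N.+1%:R^-1 :> R.
Proof. by rewrite subrr normr0 invr_ge0 ler0n. Qed.

Lemma hol_homotopy (c0 c1 : R -> plane R) : free_homotopic c0 c1 ->
  \forall N \near \oo, F3_conj (hol N c0) (hol N c1).
Proof.
case=> H [Hc Hl Hg H0 [g Gg H1]]; have := homotopy_good Hc Hl Hg.
apply: filterS => N good.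
pose P i k := H (i%:R / N.+1%:R, k%:R / N.+1%:R).
pose r i := path_trans (P i) N.+1.
have goodP i k : (i <= N)%N -> (k <= N.+1)%N -> exists U g, [/\ trans_good U, Gamma g,
     H (i%:R / N.+1%:R, 1) = g (H (i%:R / N.+1%:R, 0)),
     H (i.+1%:R / N.+1%:R, 1) = g (H (i.+1%:R / N.+1%:R, 0)) &
     forall i' k', (i' == i) || (i' == i.+1) -> (k' == k) || (k' == k.+1) -> U (P i' k')].
  move=> iN kN; have [] := good (i%:R / N.+1%:R, k%:R / N.+1%:R).
    by split; apply: mesh_itv => //; apply: ltnW.
  move=> U [h [gU Gh Uh]]; exists U, h; split => //.
  - by case: (Uh _ (k%:R / N.+1%:R) (mesh_itv (leqW iN)) (mesh_same _ _) (mesh_same _ _)).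
  - by case: (Uh _ (k%:R / N.+1%:R) (mesh_itv (iN : i.+1 <= N.+1)%N) (mesh_step _ _) (mesh_same _ _)).
  - move=> i' k' hi hk; apply: (proj1 (Uh _ _ _ _ _)).
    + by apply: mesh_itv; case/orP: hi => /eqP ->; rewrite ?ltnS // ltnW.
    + by case/orP: hi => /eqP -> /=; rewrite ?mesh_same ?mesh_step.
    + by case/orP: hk => /eqP -> /=; rewrite ?mesh_same ?mesh_step.
have nlP i k : (i <= N.+1)%N -> ~ lattice (P i k) by move=> iN; apply/Hl/mesh_itv.
have step i : (i <= N)%N -> F3_conj (r i) (r i.+1).
  move=> iN; exists (trans (P i 0%N) (P i.+1 0%N)).
  (* Rows [i] and [i.+1] share their deck transformation, so the two vertical edges of the grid have
     the same transition, which is the conjugator. *)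
  have deckE : trans (P i N.+1) (P i.+1 N.+1) = trans (P i 0%N) (P i.+1 0%N).
    have [U [h [[phi phiP] Gh h1 h2 UP]]] := goodP i 0%N iN isT.
    have U1 : U (P i 0%N) by apply: UP; rewrite !eqxx.
    have U2 : U (P i.+1 0%N) by apply: UP; rewrite !eqxx ?orbT.
    have [_ {}phiP] := phiP _ _ U1 U2 (nlP i 0%N (leqW iN)) (nlP i.+1 0%N iN).
    rewrite -(phiP _ Gh) /P mul0r divff ?pnatr_eq0 //.
    by rewrite h1 h2.
  rewrite -{1}deckE; apply: path_trans_grid => k kN.
  have [U [h [[phi phiP] _ _ _ UP]]] := goodP i k iN (ltnW kN).
  have F a b a' b' : (a == i) || (a == i.+1) -> (b == k) || (b == k.+1) ->
      (a' == i) || (a' == i.+1) -> (b' == k) || (b' == k.+1) ->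
      trans (P a b) (P a' b') = ((phi (P a b))^-1 * phi (P a' b'))%g.
    move=> h1 h2 h3 h4; apply: (proj1 (phiP _ _ (UP _ _ h1 h2) (UP _ _ h3 h4) _ _)).
      by apply: nlP; case/orP: h1 => /eqP ->; rewrite ?ltnS // ltnW.
    by apply: nlP; case/orP: h3 => /eqP ->; rewrite ?ltnS // ltnW.
  rewrite !F ?eqxx ?orbT // -!mulgA; congr (_ * _)%g.
  by rewrite !mulVKg.
have r0 : r 0%N = hol N c0.
  by apply: eq_path_trans => k kN; rewrite /P mul0r !H0.
have [g' Gg' gK] := Gamma_inv Gg.
have rN : r N.+1 = hol N c1.
  apply: eq_path_trans => k kN; have c1E j : c1 (j%:R / N.+1%:R) = g' (P N.+1 j).
    by rewrite /P divff ?pnatr_eq0 // H1 gK.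
  have [U [h [[phi phiP] _ _ _ UP]]] := goodP N k (leqnn _) (ltnW kN).
  have U1 : U (P N.+1 k) by apply: UP; rewrite !eqxx ?orbT.
  have U2 : U (P N.+1 k.+1) by apply: UP; rewrite !eqxx ?orbT.
  have [_ {}phiP] := phiP _ _ U1 U2 (@nlP _ _ (leqnn _)) (@nlP _ _ (leqnn _)).
  by rewrite -(phiP _ Gg') -!c1E.
rewrite -r0 -rN.
have : (N.+1 <= N.+1)%N by [].
elim: {-2}N.+1 => [|i IH] iN; first exact: F3_conj_refl.
by apply: F3_conj_trans (step i iN); apply: IH; apply: ltnW.
Qed.

(** The case of a constant homotopy in [homotopy_good]. *)
Lemma curve_good c : closed_curve c -> \forall N \near \oo, forall t, t \in `[0, 1] ->
  exists2 U, trans_good U & forall t', `|t - t'| <= N.+1%:R^-1 -> U (c t').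
Proof.
case=> cc cl [g Gg gc].
have [] := @homotopy_good (fun z => c z.2).
- apply: continuous_subspaceT => z; apply: continuous_comp; [exact: cvg_snd | exact: cc].
- by move=> s t _; apply: cl.
- by move=> s _; exists g.
move=> N _ h; exists N => // n /= Nn t t1.
have [|U [g' [gU _ UP]]] := h n Nn (0, t).
  by split=> //; rewrite /= in_itv /= lexx ler01.
exists U => // t' tt'; apply: (proj1 (UP 0 t' _ _ tt')).
  by rewrite in_itv /= lexx ler01.
exact: mesh_same.
Qed.

Lemma path_trans_rev (p p' : nat -> plane R) n :
  (forall k, (k < n)%N -> trans (p' k) (p' k.+1) = (trans (p (n - k.+1)%N) (p (n - k)%N))^-1%g) ->
  path_trans p' n = (path_trans p n)^-1%g.
Proof.
move=> h; have E j : (j <= n)%N -> (path_trans p n * path_trans p' j = path_trans p (n - j))%g.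
  elim: j => [|j IH] jn /=; first by rewrite mulg1 subn0.
  by rewrite mulgA IH 1?ltnW // h // -(subnSK jn) /= mulgK.
apply: (mulgI (path_trans p n)).
by rewrite mulgV E // subnn.
Qed.

Lemma hol_rev c : closed_curve c ->
  \forall N \near \oo, hol N (rev_curve c) = (hol N c)^-1%g.
Proof.
move=> Cc; have := curve_good Cc; apply: filterS => N good.
case: Cc => _ cl [g Gg gc]; have [g' Gg' gK] := Gamma_inv Gg.
apply: path_trans_rev => k kN.
(* The reversed curve is sampled at times in [-1, 0]; one period brings these back to the samples of
   [c] in reverse order, up to a deck transformation. *)
have E j : (j <= N.+1)%N -> rev_curve c (j%:R / N.+1%:R) = g' (c ((N.+1 - j)%N%:R / N.+1%:R)).
  move=> jN; rewrite natrB // mulrBl divff ?pnatr_eq0 // addrC gc gK.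
  by rewrite /rev_curve.
rewrite !E //; last exact: ltnW.
have [U [phi phiP] UP] := good _ (mesh_itv (leq_subr k.+1 N.+1)).
have U1 := UP _ (mesh_same _ _); have := UP _ (mesh_step _ _).
rewrite subnSK // => U2.
have [e1 _] := phiP _ _ U1 U2 (cl _) (cl _); have [e2 e3] := phiP _ _ U2 U1 (cl _) (cl _).
by rewrite e3 // e1 e2 invgM invgK.
Qed.

End Holonomy.

(** * Holonomy and crossing words *)

Section Crossings.
Variable R : realType.
Implicit Types (c : R -> plane R) (t s : R) (Z : seq (R * letter)).

(** The hypothesis compares each time only with the centre [t0]; the local potential of
    [trans_local] extends it to all pairs of nearby times, after which the product telescopes. [F]
    may jump. *)
Lemma hol_primitive c (F : R -> F3) : closed_curve c ->
  (forall t0, t0 \in `[0, 1] ->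
     \forall t \near t0, trans (c t0) (c t) = ((F t0)^-1 * F t)%g) ->
  \forall N \near \oo, hol N c = ((F 0%R)^-1 * F 1%R)%g.
Proof.
move=> [cc cl _] FE.
pose good (B : set (R * R)) := forall z z', B z -> B z' ->
  trans (c z.2) (c z'.2) = ((F z.2)^-1 * F z'.2)%g.
have cK : compact (`[0, 1] `*` `[0, 1] : set (R * R)).
  by apply: compact_setX; apply: segment_compact.
have /(lebesgue_number cK) : forall z : R * R, (`[0, 1] `*` `[0, 1])%classic z ->
    exists2 B, nbhs z B & good B; last first.
  apply: filterS => N h; rewrite /hol.
  have step k : (k < N.+1)%N -> trans (c (k%:R / N.+1%:R)) (c (k.+1%:R / N.+1%:R)) =
      ((F (k%:R / N.+1%:R)%R)^-1 * F (k.+1%:R / N.+1%:R)%R)%g.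
    move=> kN; have [|B gB BB] := h (0, k%:R / N.+1%:R).
      by split=> /=; [rewrite in_itv /= lexx ler01 | apply: mesh_itv; apply: ltnW].
    by apply: (gB (0, _) (0, _)); apply: BB => /=; rewrite ?mesh_same ?mesh_step.
  have E n : (n <= N.+1)%N -> path_trans (fun k => c (k%:R / N.+1%:R)) n =
      ((F 0%R)^-1 * F (n%:R / N.+1%:R)%R)%g.
    elim: n => [|n IH] nN; rewrite ?mul0r ?mulVg //=.
    by rewrite step // IH; [rewrite -mulgA mulVKg | exact: ltnW].
  by rewrite E // divff // pnatr_eq0.
move=> [s0 t0] /= [_ t01].
have [U U0 [phi phiP]] := trans_local (cl t0).
have cU : \forall t \near t0, U (c t) by apply: (cc t0).
have W : \forall t \near t0, U (c t) /\ trans (c t0) (c t) = ((F t0)^-1 * F t)%g.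
  by near=> t; split; near: t => //; apply: FE.
exists [set z | U (c z.2) /\ trans (c t0) (c z.2) = ((F t0)^-1 * F z.2)%g].
  move: W => /nbhs_ballP[d /= d0 dB].
  exists (setT, ball t0 d) => /=; first by split; [exact: filterT | exact: nbhsx_ballx].
  by move=> [a b] [/= _ h]; apply: dB.
move=> [a t] [a' t'] /= [Ut ft] [Ut' ft'].
have Ut0 : U (c t0) by apply: nbhs_singleton.
have [] := phiP _ _ Ut0 Ut (cl _) (cl _); rewrite ft => e1 _.
have [] := phiP _ _ Ut0 Ut' (cl _) (cl _); rewrite ft' => e2 _.
have [-> _] := phiP _ _ Ut Ut' (cl _) (cl _).
have -> : F t = (F t0 * (phi (c t0))^-1 * phi (c t))%g by rewrite -mulgA -e1 mulVKg.
have -> : F t' = (F t0 * (phi (c t0))^-1 * phi (c t'))%g by rewrite -mulgA -e2 mulVKg.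
by rewrite !invgM invgK -!mulgA; congr (_ * _)%g; rewrite !(mulKg, mulVKg).
Unshelve. all: by end_near. Qed.

(** A form of [crosses_at] without a translate to a base segment: the sign of the letter and the
    parity of the segment together say whether the form decreases. *)
Definition icross c t (l : letter) := exists (k : int) (e : R),
  [/\ 0 < e, lform l.1 (c t) = 2 * k%:~R &
   forall s, `|s - t| < e ->
     let down := l.2 (+) oddz (side l.1 (c t)) in
     (s < t -> if down then 2 * k%:~R < lform l.1 (c s) else lform l.1 (c s) < 2 * k%:~R) /\
     (t < s -> if down then lform l.1 (c s) < 2 * k%:~R else 2 * k%:~R < lform l.1 (c s))].

(** The link with the chosen transverse orientations: on all three base segments the orientation is
    that of the form of [x], reversed exactly when [side] is odd. *)
Lemma base_segment_orient x (p : plane R) : base_segment x p -> exists (o : bool) (k : int),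
  [/\ oddz (side x p) = o, lform x p = 2 * k%:~R &
   forall q : plane R, orient_form x q = (-1) ^+ o * (lform x q - 2 * k%:~R)].
Proof.
case: x; rewrite /= /side /=.
- move=> [/andP[h1 h2] h3]; exists false, 0; split; last by move=> q; rewrite ?expr0 ?expr1; lra.
    by rewrite (_ : Num.floor _ = 0) //; apply: floor_def; lra.
  by rewrite h3 mulr0.
- move=> [h3 /andP[h1 h2]]; exists true, 0; split; last by move=> q; rewrite ?expr0 ?expr1; lra.
    by rewrite (_ : Num.floor _ = -1) //; apply: floor_def; rewrite h3; lra.
  by rewrite h3 mulr0.
- move=> [/andP[h1 h2] h3]; exists true, (-1); split; last by move=> q; rewrite expr1 intrN; lra.
    by rewrite (_ : Num.floor _ = 1) //; apply: floor_def; lra.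
  by rewrite intrN; lra.
Qed.

Lemma crosses_at_icross c t l : ~ lattice (c t) -> crosses_at c t l -> icross c t l.
Proof.
case: l => x b nl [g Gg /= [base hm hp]].
have [e [m gE]] := Gamma_lform Gg.
have [b0 [k0 [sE k0E oE]]] := base_segment_orient base.
pose k := if e then m x - k0 else k0 - m x.
have kE : lform x (c t) = 2 * k%:~R.
  by move: k0E; rewrite gE /k; case: (e) => h; rewrite intrD intrN; lra.
have ni : lform (nxt x) (c t) \isn't a Num.int.
  by apply: not_lattice_side => //; exists k.
have {}sE : b (+) oddz (side x (c t)) = b (+) (e (+) b0).
  by rewrite -sE (side_Gamma gE) ?ni ?implybT //; case: (e); case: (oddz _).
have hE s : (-1) ^+ b * orient_form x (g (c s)) =
    (-1) ^+ (b (+) oddz (side x (c t))) * (lform x (c s) - 2 * k%:~R).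
  rewrite oE gE sE /k.
  by case: (e) => /=; case: (b); case: (b0) => /=; rewrite ?expr0 ?expr1 intrD intrN; lra.
move: hm hp; rewrite /at_left /at_right /within /= => /nbhs_ballP[d1 /= d10 hm] /nbhs_ballP[d2 /= d20 hp].
exists k, (Num.min d1 d2); split; [by rewrite lt_min d10 d20 | exact: kE |].
move=> s; rewrite lt_min => /andP[s1 s2] /=; split => st.
  have := hm s; rewrite /ball /= distrC => /(_ s1 st); rewrite hE.
  by case: (b (+) _); rewrite ?expr0 ?expr1; lra.
have := hp s; rewrite /ball /= distrC => /(_ s2 st); rewrite hE.
by case: (b (+) _); rewrite ?expr0 ?expr1; lra.
Qed.

Lemma icross_Gamma c (g : plane R -> plane R) t l : (forall t, ~ lattice (c t)) ->
  (forall t, c (t + 1) = g (c t)) -> Gamma g -> icross c t l -> icross c (t + 1) l.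
Proof.
move=> nl gc Gg [k [e [e0 kE H]]]; have [e' [m gE]] := Gamma_lform Gg.
have ni : lform (nxt l.1) (c t) \isn't a Num.int.
  by apply: not_lattice_side => //; exists k.
have sE : oddz (side l.1 (g (c t))) = e' (+) oddz (side l.1 (c t)).
  by rewrite (side_Gamma gE) ?ni ?implybT.
exists (if e' then m l.1 - k else k + m l.1), e; split=> //.
  by rewrite gc gE kE; case: (e'); rewrite intrD ?intrN; lra.
move=> s st; have sE' : s = (s - 1) + 1 by rewrite subrK.
rewrite sE' !gc !gE sE !ltrD2r.
have [|h1 h2] := H (s - 1); first by rewrite (_ : s - 1 - t = s - (t + 1)) //; lra.
split=> [/h1|/h2] /=; rewrite addbCA; case: (e') => /=; case: (l.2 (+) _) => /=;
  rewrite ?intrD ?intrN; lra.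
Qed.

Lemma cut_linesP (p : plane R) : cut_lines p <-> exists x, even_at x p.
Proof.
split=> [[] [k kE]|[x [k kE]]].
- by exists ga, k; rewrite /= kE intrM.
- by exists gb, k; rewrite /= kE intrM.
- by exists gc, (- k); rewrite /= kE intrM intrN mulrN.
case: x kE => /= kE; [constructor 1|constructor 2|constructor 3].
- by exists k; rewrite intrM.
- by exists k; rewrite intrM.
- by exists (- k); rewrite intrM intrN; lra.
Qed.

Lemma trans_no_cross c t0 : closed_curve c -> ~ cut_lines (c t0) ->
  \forall t \near t0, trans (c t0) (c t) = 1%g.
Proof.
move=> [cc cl _] nc.
have H x : \forall t \near t0, lev x (c t) = lev x (c t0).
  have nex : ~ even_at x (c t0) by move=> ex; apply/nc/cut_linesP; exists x.
  exact: (cc t0 _ (lev_near nex)).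
near=> t; rewrite (@trans_single _ ga) => [|y _]; last first.
  by apply/esym; case: y; near: t; apply: H.
by apply: trans1_eq; apply/esym; near: t; apply: H.
Unshelve. all: by end_near. Qed.

Lemma trans_cross c t0 l : closed_curve c -> icross c t0 l ->
  \forall t \near t0, trans (c t0) (c t) =
    (if (if l.2 then t < t0 else t0 < t) then F3_of [:: (l.1, false)] else 1)%g.
Proof.
case: l => x b [cc cl _] [k [e [e0 /= kE H]]].
have ex : even_at x (c t0) by exists k.
have Hs := side_near (not_lattice_side (cl t0) ex).
have Hf : \forall p \near c t0, 2 * k%:~R - 2 < lform x p < 2 * k%:~R + 2.
  by apply: lform_near; rewrite kE; lra.
have Hy y : \forall p \near c t0, y <> x -> lev y (c t0) = lev y p.
  have [->|yx] := pselect (y = x); first by near=> p.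
  have := lev_near (not_lattice_even (cl t0) (fun e => yx (esym e)) ex).
  by apply: filterS => p + _.
have {}Hs : \forall t \near t0, side x (c t) = side x (c t0).
  have := cc t0 _ Hs; rewrite nbhs_simpl /= => h.
  by near=> t; have [] : side x (c t) = side x (c t0) /\ lform (nxt x) (c t) \isn't a Num.int by near: t.
have {}Hf : \forall t \near t0, 2 * k%:~R - 2 < lform x (c t) < 2 * k%:~R + 2.
  exact: (cc t0 _ Hf).
have {}Hy y : \forall t \near t0, y <> x -> lev y (c t0) = lev y (c t).
  exact: (cc t0 _ (Hy y)).
have He : \forall t \near t0, `|t - t0| < e.
  by apply/nbhs_ballP; exists e => //= t; rewrite /ball /= distrC.
near=> t.
have te : `|t - t0| < e by near: t.
have st : side x (c t) = side x (c t0) by near: t.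
have /andP[f1 f2] : 2 * k%:~R - 2 < lform x (c t) < 2 * k%:~R + 2 by near: t.
rewrite (@trans_single _ x); last by case; near: t; apply: Hy.
have [hl hr] := H t te.
have lo n : oddz (side x (c t0)) -> 2 * n%:~R <= lform x (c t) < 2 * n%:~R + 2 -> lev x (c t) = n.
  by move=> o; apply: lev_odd; rewrite st.
have le n : oddz (side x (c t0)) = false ->
    2 * n%:~R < lform x (c t) <= 2 * n%:~R + 2 -> lev x (c t) = n.
  by move=> o; apply: lev_even; rewrite st.
have tt : t = t0 -> lform x (c t) = 2 * k%:~R by move=> ->.
have [k1 k2 _] := int_pred_cmp k.
rewrite /trans1; case o: (oddz (side x (c t0))) hl hr lo le => /= hl hr lo le.
  have -> : lev x (c t0) = k by apply: lev_odd => //; rewrite kE; lra.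
  have lhi : 2 * k%:~R <= lform x (c t) -> lev x (c t) = k by move=> h; apply: lo => //; lra.
  have llo : lform x (c t) < 2 * k%:~R -> lev x (c t) = k - 1.
    by move=> h; apply: lo => //; rewrite intrD intrN; lra.
  case: (ltgtP t t0) hl hr tt => [h1|h1|h1] hl hr tt.
  - move: (hl isT); case: (b) => /= h; last by rewrite lhi ?ltxx //; lra.
    by rewrite llo // k1 k2.
  - move: (hr isT); case: (b) => /= h; first by rewrite lhi ?ltxx //; lra.
    by rewrite llo // k1 k2.
  - by rewrite lhi ?ltxx ?(tt h1) // if_same.
have -> : lev x (c t0) = k - 1 by apply: lev_even => //; rewrite kE intrD intrN; lra.
have lhi : 2 * k%:~R < lform x (c t) -> lev x (c t) = k by move=> h; apply: le => //; lra.
have llo : lform x (c t) <= 2 * k%:~R -> lev x (c t) = k - 1.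
  by move=> h; apply: le => //; rewrite intrD intrN; lra.
case: (ltgtP t t0) hl hr tt => [h1|h1|h1] hl hr tt.
- move: (hl isT); case: (b) => /= h; last by rewrite llo ?ltxx //; lra.
  by rewrite lhi // k2.
- move: (hr isT); case: (b) => /= h; first by rewrite llo ?ltxx //; lra.
  by rewrite lhi // k2.
- by rewrite llo ?ltxx ?(tt h1) // if_same.
Unshelve. all: by end_near. Qed.

(** The letters read before time [t]. At a crossing time a generator is not yet counted while an
    inverse already is: by the half-open convention a point of a line belongs to the side from which
    the positive crossing starts. *)
Definition prim Z t : F3 :=
  F3_of [seq z.2 | z <- Z & (z.1 < t) || ((z.1 == t) && z.2.2)].

Lemma prim_near Z t0 : \forall t \near t0, forall z, z \in Z -> z.1 != t0 ->
  (z.1 < t) = (z.1 < t0) /\ (z.1 == t) = false.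
Proof.
elim: Z => [|z Z IH]; first by near=> t.
have H : \forall t \near t0, z.1 != t0 -> (z.1 < t) = (z.1 < t0) /\ (z.1 == t) = false.
  have [zt|zt|<-] := ltgtP z.1 t0; last by near=> t.
  - near=> t => _; have zt' : z.1 < t by near: t; apply: lt_nbhsr.
    by rewrite zt' lt_eqF.
  - near=> t => _; have zt' : t < z.1 by near: t; apply: lt_nbhsl.
    by rewrite gt_eqF // ltNge ltW.
near=> t => y; rewrite in_cons => /orP[/eqP ->|yZ]; first by near: t.
by move: y yZ; near: t.
Unshelve. all: by end_near. Qed.

Lemma prim_local c Z t0 : closed_curve c -> sorted <%R (map fst Z) ->
  (forall z, z \in Z -> icross c z.1 z.2) ->
  (cut_lines (c t0) -> t0 \in map fst Z) ->
  \forall t \near t0, trans (c t0) (c t) = ((prim Z t0)^-1 * prim Z t)%g.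
Proof.
move=> Cc sZ cZ cutZ; have Zn := prim_near Z t0.
have [/mapP[[t1 l] zZ /= tE]|nZ] := boolP (t0 \in map fst Z); last first.
  have tn := trans_no_cross Cc (contra_not cutZ (negP nZ)).
  near=> t; have -> : trans (c t0) (c t) = 1%g by near: t.
  have Zt : forall z, z \in Z -> z.1 != t0 -> (z.1 < t) = (z.1 < t0) /\ (z.1 == t) = false by near: t.
  suff -> : prim Z t = prim Z t0 by rewrite mulVg.
  congr (F3_of (map _ _)); apply: eq_in_filter => z zZ.
  have zt0 : z.1 != t0 by apply: contra nZ => /eqP <-; apply: map_f.
  by have [-> ->] := Zt z zZ zt0; rewrite (negPf zt0).
subst t1; have tc := trans_cross Cc (cZ _ zZ).
case/splitPr: zZ sZ {cZ cutZ} Zn => Z1 Z2.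
rewrite map_cat lt_sorted_pairwise pairwise_cat /= => /and3P[/allrelP H1 _ /andP[/allP H2 _]] Zn.
have Z1lt z : z \in Z1 -> z.1 < t0.
  by move=> zZ; apply: H1; rewrite ?map_f ?mem_head.
have Z2lt z : z \in Z2 -> t0 < z.1 by move=> zZ; apply: H2; rewrite map_f.
have primE t : (forall z, z \in Z1 ++ (t0, l) :: Z2 -> z.1 != t0 ->
     (z.1 < t) = (z.1 < t0) /\ (z.1 == t) = false) \/ t = t0 ->
   prim (Z1 ++ (t0, l) :: Z2) t =
     (F3_of (map snd Z1) * if (t0 < t) || ((t0 == t) && l.2) then F3_of [:: l] else 1)%g.
  move=> Zt.
  have E1 : [seq z <- Z1 | (z.1 < t) || ((z.1 == t) && z.2.2)] = Z1.
    apply/all_filterP/allP => z zZ; have lt := Z1lt z zZ.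
    case: Zt => [Zt|->]; last by rewrite lt.
    have [|| -> _] := Zt z; rewrite ?mem_cat ?zZ ?lt //.
    by rewrite lt_eqF.
  have E2 : [seq z <- Z2 | (z.1 < t) || ((z.1 == t) && z.2.2)] = [::].
    apply/eqP; rewrite -size_eq0 size_filter -leqn0 leqNgt -has_count; apply/hasPn => z zZ.
    have lt := Z2lt z zZ.
    case: Zt => [Zt|->]; last by rewrite ltNge ltW //= gt_eqF.
    have [|| -> ->] := Zt z; rewrite ?mem_cat ?in_cons ?zZ ?orbT //.
      by rewrite gt_eqF.
    by rewrite ltNge ltW.
  rewrite /prim filter_cat E1 /= E2; case: ifP => _; rewrite map_cat F3_of_cat //.
near=> t.
have -> : trans (c t0) (c t) = (if (if l.2 then t < t0 else t0 < t) then F3_of [:: (l.1, false)] else 1)%g by near: t.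
have Zt : forall z, z \in Z1 ++ (t0, l) :: Z2 -> z.1 != t0 ->
     (z.1 < t) = (z.1 < t0) /\ (z.1 == t) = false by near: t.
rewrite (primE t0 (or_intror erefl)) (primE t (or_introl Zt)) ltxx eqxx /=.
clear; case: l => x [] /=.
  have V : (F3_of [:: (x, true)])^-1%g = F3_of [:: (x, false)] by rewrite -F3_of_winv.
  rewrite invgM -mulgA (mulKg (F3_of (map snd Z1))) V andbT.
  have <- : (t0 <= t) = (t0 < t) || (t0 == t) by rewrite le_eqVlt orbC.
  by rewrite leNgt; case: ifP => _ /=; rewrite ?mulg1 // -V mulVg.
rewrite mulg1 mulKg andbF orbF //.
Unshelve. all: by end_near. Qed.

Lemma hol_word c (ts : seq R) (u : word) : closed_curve c ->
  sorted <%R ts -> size ts = size u ->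
  (forall t, t \in ts <-> 0 <= t < 1 /\ cut_lines (c t)) ->
  (forall k, (k < size u)%N -> icross c (nth 0 ts k) (nth (ga, false) u k)) ->
  \forall N \near \oo, F3_conj (hol N c) (F3_of u).
Proof.
move=> Cc sts szu tsP uP; have [cc cl [g Gg gc]] := Cc.
pose Z0 := zip ts u; pose sh (z : R * letter) := (z.1 + 1, z.2).
(* A second period of crossings is appended so that [prim Z] is a primitive also around time 1. *)
pose Z := Z0 ++ map sh Z0.
have Z0c z : z \in Z0 -> icross c z.1 z.2.
  move=> /(nthP (0, (ga, false)))[k]; rewrite size_zip szu minnn => ku <-.
  by rewrite nth_zip //=; apply: uP.
have m1 : map fst Z0 = ts by rewrite -/unzip1 unzip1_zip // szu.
have m2 : map snd Z0 = u by rewrite -/unzip2 unzip2_zip // szu.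
have mZ : map fst Z = ts ++ map (fun t => t + 1) ts.
  by rewrite map_cat m1; congr (_ ++ _); rewrite -m1 -!map_comp.
have ts01 t : t \in ts -> 0 <= t < 1 by move=> /tsP[].
have sZ : sorted <%R (map fst Z).
  rewrite mZ lt_sorted_pairwise pairwise_cat -!lt_sorted_pairwise sts /=.
  apply/andP; split.
    by apply/allrelP => x _ /ts01 /andP[_ x1] /mapP[y /ts01 /andP[y0 _] ->]; lra.
  by rewrite sorted_map; move: sts; apply: sub_sorted => x y /=; rewrite ltrD2r.
have Zc z : z \in Z -> icross c z.1 z.2.
  rewrite mem_cat => /orP[|/mapP[y yZ ->]]; first exact: Z0c.
  exact: icross_Gamma cl gc Gg (Z0c _ yZ).
have cut t : t \in `[0, 1] -> cut_lines (c t) -> t \in map fst Z.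
  rewrite in_itv /= => /andP[t0 t1] ct; rewrite mZ mem_cat.
  have [tl|tl] := boolP (t < 1); first by rewrite (_ : t \in ts) //; apply/tsP; rewrite t0.
  have tE : t = 1 by lra.
  apply/orP; right; apply/mapP; exists 0; last by rewrite add0r.
  apply/tsP; rewrite lexx ltr01; split=> //; move: ct; rewrite tE -[1]add0r gc.
  case/cut_linesP=> x [k kE]; apply/cut_linesP; exists x.
  have [e [m gE]] := Gamma_lform Gg.
  exists (if e then m x - k else k - m x); move: kE; rewrite gE.
  by case: (e); rewrite intrD intrN => kE; lra.
have := hol_primitive Cc (fun t t01 => prim_local Cc sZ Zc (cut t t01)).
apply: filterS => N ->.
(* [prim Z 0] is nontrivial only if an inverse letter is read at time 0; that letter is then read
   again at time 1, and it conjugates the holonomy to [u]. *)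
have -> : prim Z 1 = (F3_of u * prim Z 0)%g.
  rewrite /prim !filter_cat !map_cat !F3_of_cat.
  have -> : [seq z <- Z0 | (z.1 < 1) || ((z.1 == 1) && z.2.2)] = Z0.
    apply/all_filterP/allP => z zZ; have /ts01 /andP[_ ->] // : z.1 \in ts.
    by rewrite -m1 map_f.
  have -> : [seq z <- map sh Z0 | (z.1 < 0) || ((z.1 == 0) && z.2.2)] = [::].
    apply/eqP; rewrite -size_eq0 size_filter -leqn0 leqNgt -has_count; apply/hasPn => z /mapP[y yZ ->] /=.
    have /ts01 /andP[y0 _] : y.1 \in ts by rewrite -m1 map_f.
    by rewrite ltNge gt_eqF ?andFb; lra.
  rewrite m2 F3_of_nil mulg1; congr (_ * F3_of _)%g.
  rewrite filter_map -map_comp; congr map; apply: eq_filter => z /=.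
  have -> : (z.1 + 1 < 1) = (z.1 < 0) by rewrite -{2}[1]add0r ltrD2r.
  by have -> : (z.1 + 1 == 1) = (z.1 == 0) by rewrite -{2}[1]add0r (inj_eq (addIr _)).

exists ((prim Z 0%R)^-1)%g.
by rewrite -!mulgA mulgV mulg1.
Qed.

End Crossings.

(** * Words of straight lines *)

Definition line_height (X l j : int) : int := ((X * j) %/ l)%Z.

(** At even rescaled times the form of [nxt (nxt z)] is even. Between two of them exactly one other
    line is met: one of [nxt z] if the height passes an even integer, which the halved floors at
    [j - 1] and [j + 1] detect, and one of [z] otherwise. *)
Definition line_letter (z : gen) (X l j : int) : letter :=
  let E := line_height X l in
  if ~~ oddz j then (nxt (nxt z), oddz (E j))
  else if (E (j - 1) %/ 2)%Z == (E (j + 1) %/ 2)%Z then (z, oddz (E j))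
  else (nxt z, ~~ oddz (E j)).

Definition line_word (z : gen) (X l : int) : word :=
  mkseq (fun i => line_letter z X l i%:Z) (2 * `|l|)%N.

Lemma size_line_word z X l : size (line_word z X l) = (2 * `|l|)%N.
Proof. exact: size_mkseq. Qed.

Section Lines.
Variable R : realType.
Implicit Types (c : R -> plane R) (t s : R).

Lemma icross_increasing c t0 g b (k : int) (u v : R) : 0 < u ->
  (forall t, lform g (c t) = u * t + v) -> lform g (c t0) = 2 * k%:~R ->
  b = oddz (side g (c t0)) -> icross c t0 (g, b).
Proof.
move=> u0 cE kE ->; exists k, 1; split=> // s _ /=; rewrite addbb /=.
rewrite -kE !cE; split=> st; rewrite ltrD2r ltr_pM2l //.
Qed.

Lemma icross_decreasing c t0 g b (k : int) (u v : R) : 0 < u ->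
  (forall t, lform g (c t) = - (u * t) + v) -> lform g (c t0) = 2 * k%:~R ->
  b = ~~ oddz (side g (c t0)) -> icross c t0 (g, b).
Proof.
move=> u0 cE kE ->; exists k, 1; split=> // s _ /=; rewrite addNb addbb /=.
rewrite -kE !cE; split=> st; rewrite ltrD2r ltrN2 ltr_pM2l //.
Qed.

(** In the time [s = L t] the forms of [z] and [nxt z] are nondecreasing with sum [s], so over an
    interval between consecutive even times just one of them takes an even value. The shift [eps]
    keeps both off the integers at integer times. *)
Lemma line_cross c z (X l j : int) (r eps L : R) :
  let E := line_height X l in
  0 <= r <= 1 -> 0 < L ->
  (forall t, lform z (c t) = (1 - r) * (L * t) - eps) ->
  (forall t, lform (nxt z) (c t) = r * (L * t) + eps) ->
  (forall j, (E j)%:~R < r * j%:~R + eps < (E j)%:~R + 1) ->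
  exists s, [/\ if oddz j then j%:~R - 1 < s < j%:~R + 1 else s == j%:~R,
    icross c (s / L) (line_letter z X l j) &
    oddz j -> forall s', j%:~R - 1 < s' < j%:~R + 1 ->
      even_at z (c (s' / L)) \/ even_at (nxt z) (c (s' / L)) -> s' = s].
Proof.
move=> E /andP[r0 r1] L0 c0 c1 hE.
have LK s : L * (s / L) = s by rewrite mulrCA divff ?gt_eqF // mulr1.
have c2 t : lform (nxt (nxt z)) (c t) = - (L * t) + 0.
  by have := lform_sum z (c t); rewrite c0 c1; lra.
have n3 : nxt (nxt (nxt z)) = z by case: (z).
have [e1 e2] := andP (hE j).
rewrite /line_letter -/E; case oj: (oddz j) => /=; last first.
  exists j%:~R; split=> //.
  pose k := - (j %/ 2)%Z.
  apply: (@icross_decreasing _ _ _ _ k L 0) => //.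
    rewrite c2 LK; have -> : j = 2 * - k by move: oj; rewrite /k /oddz; lia.
    by rewrite intrM intrN; lra.
  rewrite /side n3.
  have -> : Num.floor (lform z (c (j%:~R / L))) = j - 1 - E j.
    by apply: floor_def; rewrite c0 LK !(intrD, intrN); lra.
  by move: oj; rewrite /oddz; clear; lia.
have [f1 f2] := andP (hE (j - 1)); have [g1 g2] := andP (hE (j + 1)).
rewrite !(intrD, intrN) in f1 f2 g1 g2.
have Ele : E (j - 1) <= E (j + 1) <= E (j - 1) + 2.
  have h1 : (E (j - 1))%:~R < (E (j + 1) + 1)%:~R :> R by rewrite intrD; lra.
  have h2 : (E (j + 1))%:~R < (E (j - 1) + 3)%:~R :> R by rewrite intrD; lra.
  by move: h1 h2; rewrite !ltr_int; clear; lia.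
set n := (E (j + 1) %/ 2)%Z.
have [nA|nB] := eqVneq (E (j - 1) %/ 2)%Z n.
  have [xlo xhi] : 2 * n%:~R < r * (j%:~R - 1) + eps /\ r * (j%:~R + 1) + eps < 2 * n%:~R + 2.
    have h1 : 2 * n <= E (j - 1) by move: nA; clear; lia.
    have h2 : E (j + 1) + 1 <= 2 * n + 2 by rewrite /n; clear; lia.
    by move: h1 h2; rewrite -!(ler_int R) !(intrD, intrM); lra.
  have rlt : r < 1 by lra.
  clear f1 f2 g1 g2.
  pose s := (j%:~R - 1 - 2 * n%:~R + eps) / (1 - r).
  have sE : (1 - r) * s = j%:~R - 1 - 2 * n%:~R + eps.
    by rewrite /s mulrCA divff ?mulr1 //; lra.
  have hs : j%:~R - 1 < s < j%:~R + 1.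
    have p0 : 0 < 1 - r by lra.
    by apply/andP; split; rewrite -(ltr_pM2l p0) sE; lra.
  exists s; split=> //.
    pose k := ((j - 1) %/ 2)%Z - n.
    have kE : 2 * k = j - 1 - 2 * n by move: oj; rewrite /k /oddz; clear; lia.
    apply: (@icross_increasing _ _ _ _ k ((1 - r) * L) (- eps)).
    + by apply: mulr_gt0 => //; lra.
    + by move=> t; rewrite c0 mulrA.
    + have : (2 * k)%:~R = (j - 1 - 2 * n)%:~R :> R by rewrite kE.
      by rewrite c0 LK sE !(intrD, intrM, intrN); lra.
    have xs : lform (nxt z) (c (s / L)) = s - j%:~R + 1 + 2 * n%:~R.
      by rewrite c1 LK; lra.
    rewrite /side xs.
    (* The sign is a floor at the crossing time [s], whereas [E j] is a floor at time [j]. Both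
       heights lie below [2 * n + 1] exactly when [s < j], since the form of [z] increases. *)
    have [sj|sj|sj] := ltgtP s j%:~R.
    - have -> : Num.floor (s - j%:~R + 1 + 2 * n%:~R) = 2 * n.
        by apply: floor_def; rewrite !(intrD, intrM); lra.
      suff -> : E j = 2 * n by [].
      have : r * (j%:~R - s) >= 0 by apply: mulr_ge0 => //; lra.
      have h0 : r * s = s - j%:~R + 1 + 2 * n%:~R - eps by lra.
      move=> h; have h1 : (E j)%:~R < (2 * n + 1)%:~R :> R.
        rewrite intrD intrM.
        have : (1 - r) * s < (1 - r) * j%:~R by rewrite ltr_pM2l //; lra.
        by rewrite sE; lra.
      have h2 : (2 * n - 1)%:~R < (E j)%:~R :> R by rewrite intrD intrN intrM; lra.
      by move: h1 h2; rewrite !ltr_int; clear; lia.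
    - have -> : Num.floor (s - j%:~R + 1 + 2 * n%:~R) = 2 * n + 1.
        by apply: floor_def; rewrite !(intrD, intrM); lra.
      suff -> : E j = 2 * n + 1 by [].
      have h1 : (2 * n)%:~R < (E j)%:~R :> R.
        rewrite intrM.
        have : (1 - r) * j%:~R < (1 - r) * s by rewrite ltr_pM2l //; lra.
        by rewrite sE; lra.
      have h2 : (E j)%:~R < (2 * n + 2)%:~R :> R by rewrite intrD intrM; lra.
      by move: h1 h2; rewrite !ltr_int; clear; lia.
    - have : (2 * n + 1 - 1)%:~R < (E j)%:~R + 1 :> R /\ (E j)%:~R < (2 * n + 1)%:~R :> R.
        by move: sE; rewrite sj !(intrD, intrM, intrN); lra.
      move: sE; rewrite sj => sE [].
      have h1 : (E j)%:~R < (2 * n + 1)%:~R :> R by rewrite intrD intrM; lra.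
      have h2 : (2 * n + 1)%:~R < (E j + 1)%:~R :> R by rewrite !intrD intrM; lra.
      by move: h1 h2; rewrite !ltr_int; clear; lia.
  clear hs e1 e2 => _ s' /andP[s1 s2] [[k kE]|[k kE]]; last first.
    move: kE; rewrite c1 LK => kE.
    have q1 : r * (s' - (j%:~R - 1)) >= 0 by apply: mulr_ge0; lra.
    have q2 : r * (j%:~R + 1 - s') >= 0 by apply: mulr_ge0; lra.
    have h1 : (2 * n)%:~R < (2 * k)%:~R :> R by rewrite !intrM; lra.
    have h2 : (2 * k)%:~R < (2 * n + 2)%:~R :> R by rewrite !(intrD, intrM); lra.
    by exfalso; move: h1 h2; rewrite !ltr_int; clear; lia.
  move: kE; rewrite c0 LK => kE.
  have q1 : (1 - r) * (s' - (j%:~R - 1)) >= 0 by apply: mulr_ge0; lra.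
  have q2 : (1 - r) * (j%:~R + 1 - s') >= 0 by apply: mulr_ge0; lra.
  have kn : 2 * k = j - 1 - 2 * n.
    have h1 : (j - 3 - 2 * n)%:~R < (2 * k)%:~R :> R by rewrite !(intrD, intrN, intrM); lra.
    have h2 : (2 * k)%:~R < (j + 1 - 2 * n)%:~R :> R by rewrite !(intrD, intrN, intrM); lra.
    by move: oj h1 h2; rewrite !ltr_int /oddz; clear; lia.
  have kn' : (2 * k)%:~R = (j - 1 - 2 * n)%:~R :> R by rewrite kn.
  rewrite !(intrD, intrN, intrM) in kn'.
  by apply: (mulfI (_ : 1 - r != 0)); lra.
have nB' : (E (j - 1) %/ 2)%Z = n - 1 by move: Ele nB; rewrite /n; clear; lia.
have [xlo1 xlo2] : 2 * n%:~R - 2 < r * (j%:~R - 1) + eps /\ r * (j%:~R - 1) + eps < 2 * n%:~R.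
  have h1 : 2 * n - 2 <= E (j - 1) by move: nB'; clear; lia.
  have h2 : E (j - 1) + 1 <= 2 * n by move: nB'; clear; lia.
  by move: h1 h2; rewrite -!(ler_int R) !(intrD, intrM, intrN); lra.
have [xhi1 xhi2] : 2 * n%:~R < r * (j%:~R + 1) + eps /\ r * (j%:~R + 1) + eps < 2 * n%:~R + 2.
  have h1 : 2 * n <= E (j + 1) by rewrite /n; clear; lia.
  have h2 : E (j + 1) + 1 <= 2 * n + 2 by rewrite /n; clear; lia.
  by move: h1 h2; rewrite -!(ler_int R) !(intrD, intrM, intrN); lra.
have rgt : 0 < r by lra.
clear f1 f2 g1 g2.
pose s := (2 * n%:~R - eps) / r.
have sE : r * s = 2 * n%:~R - eps by rewrite /s mulrCA divff ?mulr1 //; lra.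
have hs : j%:~R - 1 < s < j%:~R + 1.
  by apply/andP; split; rewrite -(ltr_pM2l rgt) sE; lra.
exists s; split=> //.
  apply: (@icross_increasing _ _ _ _ n (r * L) eps).
  + exact: mulr_gt0.
  + by move=> t; rewrite c1 mulrA.
  + by rewrite c1 LK sE; lra.
  rewrite /side c2 LK addr0.
  have [sj|sj|sj] := ltgtP s j%:~R.
  - have -> : Num.floor (- s) = - j by apply: floor_def; rewrite intrD intrN; lra.
    have : r * s < r * j%:~R by rewrite ltr_pM2l.
    rewrite sE => h.
    suff -> : E j = 2 * n by move: oj; rewrite /oddz; clear; lia.
    have h1 : (2 * n - 1)%:~R < (E j)%:~R :> R by rewrite intrD intrN intrM; lra.
    have h2 : (E j)%:~R < (2 * n + 1)%:~R :> R by rewrite intrD intrM; lra.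
    by move: h1 h2; rewrite !ltr_int; clear; lia.
  - have -> : Num.floor (- s) = - j - 1 by apply: floor_def; rewrite !(intrD, intrN); lra.
    have : r * j%:~R < r * s by rewrite ltr_pM2l.
    rewrite sE => h.
    suff -> : E j = 2 * n - 1 by move: oj; rewrite /oddz; clear; lia.
    have h1 : (2 * n - 2)%:~R < (E j)%:~R :> R by rewrite intrD intrN intrM; lra.
    have h2 : (E j)%:~R < (2 * n)%:~R :> R by rewrite intrM; lra.
    by move: h1 h2; rewrite !ltr_int; clear; lia.
  - rewrite sj in sE; exfalso.
    have h1 : (E j)%:~R < (2 * n)%:~R :> R by rewrite intrM; lra.
    have h2 : (2 * n)%:~R < (E j + 1)%:~R :> R by rewrite intrD intrM; lra.
    by move: h1 h2; rewrite !ltr_int; clear; lia.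
clear hs e1 e2 => _ s' /andP[s1 s2] [[k kE]|[k kE]].
  move: kE; rewrite c0 LK => kE.
  have q1 : (1 - r) * (s' - (j%:~R - 1)) >= 0 by apply: mulr_ge0; lra.
  have q2 : (1 - r) * (j%:~R + 1 - s') >= 0 by apply: mulr_ge0; lra.
  have h1 : (j - 1 - 2 * n)%:~R < (2 * k)%:~R :> R by rewrite !(intrD, intrN, intrM); lra.
  have h2 : (2 * k)%:~R < (j + 1 - 2 * n)%:~R :> R by rewrite !(intrD, intrN, intrM); lra.
  by exfalso; move: oj h1 h2; rewrite !ltr_int /oddz; clear; lia.
move: kE; rewrite c1 LK => kE.
have q1 : r * (s' - (j%:~R - 1)) >= 0 by apply: mulr_ge0; lra.
have q2 : r * (j%:~R + 1 - s') >= 0 by apply: mulr_ge0; lra.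
have kn : k = n.
  have h1 : (2 * n - 2)%:~R < (2 * k)%:~R :> R by rewrite !(intrD, intrN, intrM); lra.
  have h2 : (2 * k)%:~R < (2 * n + 2)%:~R :> R by rewrite !(intrD, intrN, intrM); lra.
  by move: h1 h2; rewrite !ltr_int; clear; lia.
rewrite kn in kE.
by apply: (mulfI (_ : r != 0)); lra.
Qed.

End Lines.

Lemma cyc_reduced_winv u : cyc_reduced (winv u) = cyc_reduced u.
Proof.
rewrite /cyc_reduced /winv rev_cycle cycle_map.
by apply: eq_cycle => x y /=; apply: no_cancel_linv.
Qed.

Lemma line_height_period X l j k : l != 0 ->
  line_height X l (j + k * l) = line_height X l j + k * X.
Proof.
move=> l0; rewrite /line_height mulrDr mulrA mulrC [X * k]mulrC divzDr ?dvdz_mull //.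
by rewrite mulzK.
Qed.

Lemma line_letter_period z X l j : l != 0 -> line_letter z X l (j + 2 * l) = line_letter z X l j.
Proof.
move=> l0; rewrite /line_letter oddz2 !line_height_period // oddz2.
have -> : j + 2 * l - 1 = j - 1 + 2 * l by lia.
have -> : j + 2 * l + 1 = j + 1 + 2 * l by lia.
rewrite !line_height_period //.
have e a : ((a + 2 * X) %/ 2)%Z = (a %/ 2)%Z + X by lia.
by rewrite !e (inj_eq (addIr _)).
Qed.

Lemma line_letter_no_cancel z X l j :
  no_cancel (line_letter z X l j) (line_letter z X l (j + 1)).
Proof.
have o : oddz (j + 1) = ~~ oddz j by rewrite /oddz; lia.
apply/eqP => /(congr1 fst); rewrite /line_letter o.
by case: (oddz j) => /=; case: ifP => _; case: z.
Qed.

Lemma cyc_reduced_line_word z X l : 0 < l -> cyc_reduced (line_word z X l).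
Proof.
move=> l0; rewrite /line_word; set f := fun i : nat => _.
have [n nE] : exists n, (2 * `|l|)%N = n.+1 by exists (2 * `|l|).-1; lia.
have f0 : f 0%N = f n.+1.
  rewrite /f -nE -(line_letter_period z X 0) ?gt_eqF //; congr line_letter; lia.
rewrite nE /mkseq /= {2}f0 -map_rcons -cats1 -(iotaD 1 n 1).
move: (n + 1)%N => m.
apply/(pathP (f 0%N)) => i; rewrite size_map size_iota => im.
have E : nth (f 0%N) (f 0%N :: [seq f i | i <- iota 1 m]) i = f i.
  case: i im => //= i im; rewrite (nth_map 0%N) ?size_iota; last lia.
  by rewrite nth_iota //; lia.
rewrite E (nth_map 0%N) ?size_iota // nth_iota // /f add1n -addn1 PoszD.
exact: line_letter_no_cancel.
Qed.

Lemma gen_cases (x z : gen) : [\/ x = z, x = nxt z | x = nxt (nxt z)].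
Proof. by case: x; case: z; first [by constructor 1 | by constructor 2 | by constructor 3]. Qed.

Section LineHolonomy.
Variable R : realType.
Implicit Types (c : R -> plane R) (t s : R).

(** The numbers X j / l are multiples of 1 / l; moving them up by half a step preserves the floor
    and avoids integers. *)
Lemma line_height_bounds (X l j : int) : 0 < l ->
  let y : R := X%:~R / l%:~R * j%:~R + (2 * l%:~R)^-1 in
  (line_height X l j)%:~R < y < (line_height X l j)%:~R + 1.
Proof.
move=> l0; rewrite [X in is_true X]/=; set y : R := _ / _ * _ + _; have lR : (0 : R) < l%:~R by rewrite ltr0z.
have h1 : line_height X l j * l <= X * j by rewrite /line_height; lia.
have h2 : X * j + 1 <= (line_height X l j + 1) * l by rewrite /line_height; nia.
have -> : y = ((X * j)%:~R + 2^-1) / l%:~R.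
  by rewrite /y intrM invfM mulrDl mulrAC.
rewrite ltr_pdivlMr // ltr_pdivrMr //.
move: h1 h2; rewrite -!(ler_int R) !(intrD, intrM); lra.
Qed.

Lemma line_hol c z (X l : int) : closed_curve c -> 0 < l -> 0 <= X <= l ->
  (forall t, lform z (c t) = (1 - X%:~R / l%:~R) * (2 * l%:~R * t) - (2 * l%:~R)^-1) ->
  (forall t, lform (nxt z) (c t) = X%:~R / l%:~R * (2 * l%:~R * t) + (2 * l%:~R)^-1) ->
  \forall N \near \oo, F3_conj (hol N c) (F3_of (line_word z X l)).
Proof.
move=> Cc l0 /andP[X0 Xl] c0 c1; have lR : (0 : R) < l%:~R by rewrite ltr0z.
set L := 2 * l%:~R in c0 c1 *; have L0 : 0 < L by rewrite mulr_gt0.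
set r := X%:~R / l%:~R in c0 c1 *.
have r01 : 0 <= r <= 1.
  by rewrite /r divr_ge0 ?ler0z ?(ltW lR) ?(ltW l0) //= ler_pdivrMr // mul1r ler_int.
have [tau tauP] := choice (fun j => line_cross j r01 L0 c0 c1 (fun j => line_height_bounds X j l0)).
set n := (2 * `|l|)%N; have nL : n%:R = L.
  by rewrite /n /L natrM -[in RHS](gtz0_abs l0).
have tau_itv (i : nat) : if odd i then i%:R - 1 < tau i%:Z < i%:R + 1 else tau i%:Z == i%:R.
  have [h _ _] := tauP i%:Z.
  have -> : odd i = oddz i%:Z by rewrite /oddz; lia.
  exact: h.
have tau_lt (i : nat) : tau i%:Z < tau i.+1%:Z.
  have := tau_itv i; have := tau_itv i.+1; rewrite /= -natr1.
  case: (odd i) => /= [/eqP -> /andP[_ //]|/andP[h _] /eqP ->]; lra.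
apply: (@hol_word _ c (mkseq (fun i => tau i%:Z / L) n)) => //.
- apply/(sortedP 0) => i; rewrite size_mkseq => iN.
  by rewrite !nth_mkseq //; [rewrite ltr_pM2r ?invr_gt0 | apply: ltnW].
- by rewrite !size_mkseq.
- move=> t; split.
    move=> /mapP[i]; rewrite mem_iota add0n => /andP[_ iN] ->; split.
      have h : 0 <= tau i%:Z < L.
        have i1 : i%:R + 1 <= L by rewrite -nL natr1 ler_nat.
        have i0 : 0 <= i%:R :> R by rewrite ler0n.
        have := tau_itv i; case: ifP => oi; last by move/eqP ->; lra.
        move=> /andP[h1 h2]; have : (1 : R) <= i%:R by rewrite ler1n; case: (i) oi.
        by lra.
      by case/andP: h => h1 h2; rewrite divr_ge0 ?(ltW L0) //= ltr_pdivrMr // mul1r.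
    have [_ [k [e [_ kE _]]] _] := tauP i%:Z.
    by apply/cut_linesP; exists (line_letter z X l i%:Z).1, k.
  move=> [/andP[t0 t1] /cut_linesP[x ex]].
  have c2 : lform (nxt (nxt z)) (c t) = - (L * t) by have := lform_sum z (c t); rewrite c0 c1; lra.
  have s0 : 0 <= L * t by rewrite mulr_ge0 // ltW.
  have s1 : L * t < L by rewrite -[ltRHS]mulr1 ltr_pM2l.
  have tE : L * t / L = t by rewrite mulrAC divff ?gt_eqF // mul1r.
  (* Conversely, a cut time is an even integer in the rescaled time, or falls between two such
     integers, where the uniqueness in [line_cross] identifies it. *)
  have [ev|nev] := pselect (even_at (nxt (nxt z)) (c t)).
    case: ev => k kE; rewrite c2 in kE.
    have sk : L * t = (2 * - k)%:~R by rewrite intrM intrN; lra.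
    have k0 : 0 <= 2 * - k by rewrite -(ler_int R) -sk.
    have [i iE] : exists i : nat, 2 * - k = i%:Z.
      by exists `|(2 * - k)%R|%N; move: k0; clear; lia.
    have oi : odd i = false by move: iE; clear; lia.
    apply/mapP; exists i; last by have := tau_itv i; rewrite oi => /eqP ->; rewrite -tE sk iE.
    by rewrite mem_iota add0n -(ltr_nat R) nL; move: s1; rewrite sk iE.
  have ex' : even_at z (c t) \/ even_at (nxt z) (c t).
    have [xz|xz|xz] := gen_cases x z; rewrite xz in ex; by [left | right | case: (nev ex)].
  pose k := Num.floor (L * t / 2).
  have /andP[k1 k2] : 2 * k%:~R < L * t < 2 * k%:~R + 2.
    have := floor_itv (L * t / 2); rewrite -/k intrD => /andP[h1 h2].
    rewrite lt_neqAle; apply/andP; split; [apply/andP; split|]; [|lra|lra].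
    by apply/eqP => h; apply: nev; exists (- k); rewrite c2 -h intrN; lra.
  have k0 : 0 <= k.
    have : (-1)%:~R < k%:~R :> R by rewrite intrN; lra.
    by rewrite ltr_int; clear; lia.
  have [i iE] : exists i : nat, 2 * k + 1 = i%:Z.
    by exists `|(2 * k + 1)%R|%N; move: k0; clear; lia.
  have iR : i%:R = 2 * k%:~R + 1 :> R.
    by rewrite -[i%:R]/(i%:Z%:~R) -iE intrD intrM.
  have oi : oddz i%:Z by rewrite -iE /oddz; clear; lia.
  have [_ _ /(_ oi (L * t))] := tauP i%:Z.
  rewrite tE => /(_ _ ex') sE.
  apply/mapP; exists i; last first.
    rewrite -sE ?tE //; rewrite -[i%:Z%:~R]/(i%:R) iR; lra.
  rewrite mem_iota add0n -(ltr_nat R) nL iR.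
  have h : (2 * k)%:~R < (2 * l)%:~R :> R by rewrite !intrM -/L; lra.
  have : (2 * k + 1)%:~R < (2 * l)%:~R :> R by move: h; rewrite !ltr_int; clear; lia.
  by rewrite intrD !intrM.
- move=> i; rewrite size_mkseq => iN; rewrite !nth_mkseq //.
  by have [] := tauP i%:Z.
Qed.

End LineHolonomy.

(** * Directions, and homotopies between parallel lines *)

Definition dform (x : gen) (v : int * int) : int :=
  match x with ga => v.2 | gb => v.1 | gc => - (v.1 + v.2) end.

(* The three linear forms of a direction sum to zero; up to sign and cyclic
   symmetry those of z and nxt z are nonnegative. *)
Definition sector (z : gen) (e : bool) (v : int * int) : Prop :=
  0 <= (-1) ^+ e * dform z v /\ 0 <= (-1) ^+ e * dform (nxt z) v.

Section Slopes.
Variable R : realType.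
Implicit Types (c : R -> plane R) (t s : R) (p : plane R).

Definition line_along p (v : int * int) : R -> plane R :=
  fun t => (p.1 + t * (2 * v.1)%:~R, p.2 + t * (2 * v.2)%:~R).

(** The transverse coordinate of the line through [p]. For primitive [v] the lines that meet the
    lattice are those of integral [kappa], so a line off the lattice lies in an open unit interval
    of values. *)
Definition kappa (v : int * int) p : R := v.1%:~R * p.2 - v.2%:~R * p.1.

Lemma kappa_bezout (v : int * int) (k : int) : coprimez v.1 v.2 ->
  exists u : int * int, v.1 * u.2 - v.2 * u.1 = k.
Proof.
move=> /coprimezP[[a b] /= e].
exists (- (k * b), k * a) => /=.
have -> : v.1 * (k * a) - v.2 * - (k * b) = k * (a * v.1 + b * v.2) by ring.
by rewrite e mulr1.
Qed.

Lemma kappa_lattice (v : int * int) p : lattice p -> kappa v p \is a Num.int.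
Proof. by case=> h1 h2; rewrite /kappa rpredB // rpredM ?intr_int. Qed.

Lemma kappa_line (v : int * int) p t : kappa v (line_along p v t) = kappa v p.
Proof. by rewrite /kappa /line_along /= !intrM; ring. Qed.

Lemma kappa_not_int (v : int * int) p : coprimez v.1 v.2 ->
  (forall t, ~ lattice (line_along p v t)) -> kappa v p \isn't a Num.int.
Proof.
move=> cv nl; apply/negP => /intrP[k kE].
have [u uE] := kappa_bezout k cv.
have [v0|v0] := eqVneq v.1 0; last first.
  have vR : v.1%:~R != 0 :> R by rewrite intr_eq0.
  apply: (nl ((u.1%:~R - p.1) / (2 * v.1%:~R))).
  have uR : v.1%:~R * u.2%:~R - v.2%:~R * u.1%:~R = k%:~R :> R by rewrite -uE !(intrD, intrM, intrN).
  split; rewrite /line_along /= !intrM.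
    rewrite divfK ?mulf_neq0 ?pnatr_eq0 // addrC subrK; exact: intr_int.
  rewrite (_ : p.2 + _ * _ = u.2%:~R) ?intr_int //; apply: (mulfI vR).
  move: kE uR; rewrite /kappa => <- h.
  have -> : v.1%:~R * u.2%:~R = v.1%:~R * p.2 - v.2%:~R * p.1 + v.2%:~R * u.1%:~R :> R by rewrite -h; ring.
  by field.
have v2 : v.2 != 0.
  by apply: contraTneq cv => v2; rewrite v0 v2 /coprimez.
have vR : v.2%:~R != 0 :> R by rewrite intr_eq0.
apply: (nl ((u.2%:~R - p.2) / (2 * v.2%:~R))).
have uR : v.1%:~R * u.2%:~R - v.2%:~R * u.1%:~R = k%:~R :> R by rewrite -uE !(intrD, intrM, intrN).
split; rewrite /line_along /= !intrM; last first.
  rewrite divfK ?mulf_neq0 ?pnatr_eq0 // addrC subrK; exact: intr_int.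
rewrite v0 !mulr0 addr0 (_ : p.1 = u.1%:~R) ?intr_int //; apply: (mulfI vR).
by move: kE uR; rewrite /kappa v0; lra.
Qed.

Lemma pair_continuous (T : topologicalType) (f g : T -> R) :
  continuous f -> continuous g -> continuous (fun y => (f y, g y) : plane R).
Proof.
move=> hf hg y.
exact: (@cvg_pair _ _ _ (nbhs y) (nbhs (f y)) (nbhs (g y)) _ _ _ f g (hf y) (hg y)).
Qed.

Lemma line_along_continuous p (v : int * int) : continuous (line_along p v).
Proof.
apply: pair_continuous => t; apply: cvgD; try exact: cvg_cst;
  by apply: cvgM; [exact: cvg_id | exact: cvg_cst].
Qed.

Lemma line_along_shift p (v : int * int) t :
  line_along p v (t + 1) = line_along p v t + ((2 * v.1)%:~R : R, (2 * v.2)%:~R : R).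
Proof. by rewrite /line_along; congr (_, _) => /=; ring. Qed.

Lemma Gamma_shift (v : int * int) :
  Gamma (fun p : plane R => p + ((2 * v.1)%:~R : R, (2 * v.2)%:~R : R)).
Proof. by exists false, v.1, v.2. Qed.

Lemma line_along_closed p (v : int * int) :
  (forall t, ~ lattice (line_along p v t)) -> closed_curve (line_along p v).
Proof.
move=> nl; split=> //; first exact: line_along_continuous.
by eexists; [exact: (Gamma_shift v) | move=> t; rewrite line_along_shift].
Qed.

Lemma kappa_itv_not_lattice (v : int * int) (k : int) p :
  k%:~R < kappa v p < k%:~R + 1 -> ~ lattice p.
Proof.
move=> /andP[h1 h2] /kappa_lattice - /(_ v) /intrP[m mE]; move: h1 h2.
by rewrite mE -[k%:~R + 1](intrD _ k 1) !ltr_int; lia.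
Qed.

(** Moving the base point along a segment changes [kappa] affinely, so it stays strictly between [k]
    and [k + 1], away from the lattice. *)
Lemma line_slide p0 p1 (v : int * int) (k : int) (g : plane R -> plane R) c :
  k%:~R < kappa v p0 < k%:~R + 1 -> k%:~R < kappa v p1 < k%:~R + 1 ->
  Gamma g -> (forall t, g (c t) = line_along p1 v t) ->
  free_homotopic (line_along p0 v) c.
Proof.
move=> /andP[a0 b0] /andP[a1 b1] Gg gc.
pose P s : plane R := ((1 - s) * p0.1 + s * p1.1, (1 - s) * p0.2 + s * p1.2).
exists (fun z => line_along (P z.1) v z.2); split.
- apply: continuous_subspaceT; apply: pair_continuous => z;
  apply: cvgD; (try (apply: cvgM; [exact: cvg_snd | exact: cvg_cst]));
  apply: cvgD; apply: cvgM; try exact: cvg_cst; try exact: cvg_fst;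
  by apply: cvgB; [exact: cvg_cst | exact: cvg_fst].
- move=> s t; rewrite in_itv /= => /andP[s0 s1].
  apply: (@kappa_itv_not_lattice v k); rewrite kappa_line.
  have -> : kappa v (P s) = (1 - s) * kappa v p0 + s * kappa v p1.
    by rewrite /kappa /P /=; ring.
  have [->|sn] := eqVneq s 0; first by lra.
  have sp : 0 < s by rewrite lt_neqAle eq_sym sn.
  have h1 : 0 < s * (kappa v p1 - k%:~R) by rewrite mulr_gt0 // subr_gt0.
  have h2 : 0 < s * (k%:~R + 1 - kappa v p1) by rewrite mulr_gt0 // subr_gt0.
  have h3 : 0 <= (1 - s) * (kappa v p0 - k%:~R) by rewrite mulr_ge0; lra.
  have h4 : 0 <= (1 - s) * (k%:~R + 1 - kappa v p0) by rewrite mulr_ge0; lra.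
  by lra.
- move=> s _; eexists; first exact: (Gamma_shift v).
  by move=> t; rewrite line_along_shift.
- move=> t; congr line_along.
  by rewrite [RHS]surjective_pairing /P /=; congr (_, _); ring.
- exists g => // t; rewrite gc; congr line_along.
  by rewrite [RHS]surjective_pairing /P /=; congr (_, _); ring.
Qed.

End Slopes.

(** * The word of a simple class of given slope *)

Section Represents.
Variable R : realType.
Implicit Types (c : R -> plane R) (t s : R) (p : plane R).

Definition conj_or_inv (x y : F3) : Prop := F3_conj x y \/ F3_conj x y^-1%g.

Lemma conj_or_inv_sym x y : conj_or_inv x y -> conj_or_inv y x.
Proof.
case=> h; [left; exact: F3_conj_sym | right].
by have /F3_conj_inv := F3_conj_sym h; rewrite invgK.
Qed.

Lemma conj_or_inv_trans y x z : conj_or_inv x y -> conj_or_inv y z -> conj_or_inv x z.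
Proof.
move=> [h1|h1] [h2|h2]; [left | right | right | left].
- exact: F3_conj_trans h1 h2.
- exact: F3_conj_trans h1 h2.
- exact: F3_conj_trans h1 (F3_conj_inv h2).
- by apply: F3_conj_trans h1 _; have := F3_conj_inv h2; rewrite invgK.
Qed.

Lemma F3_conj_hol_rev c d : closed_curve c -> free_homotopic (rev_curve c) d ->
  \forall N \near \oo, F3_conj (hol N c)^-1%g (hol N d).
Proof.
move=> Cc /hol_homotopy h; near=> N.
have <- : hol N (rev_curve c) = (hol N c)^-1%g by near: N; apply: hol_rev.
by near: N.
Unshelve. all: by end_near. Qed.

Lemma curve_class_hol c d : closed_curve c -> curve_class c d ->
  \forall N \near \oo, conj_or_inv (hol N c) (hol N d).
Proof.
move=> Cc [_ [/hol_homotopy|/(F3_conj_hol_rev Cc)]]; apply: filterS => N h; first by left.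
by right; have := F3_conj_inv h; rewrite invgK.
Qed.

Lemma crossing_word_hol c u : closed_curve c -> crossing_word c u ->
  \forall N \near \oo, F3_conj (hol N c) (F3_of u).
Proof.
move=> Cc [ts [sts szu tsP uP]]; have [_ nl _] := Cc.
apply: (hol_word Cc sts szu tsP) => k ku.
by apply: crosses_at_icross; [exact: nl | exact: uP].
Qed.

(* The base point of the standard line lies just off the origin, on the line
   where the form of nxt (nxt z) vanishes. *)
Definition std_point (z : gen) (e : R) : plane R :=
  match z with ga => (e, - e) | gb => (- e, 0) | gc => (0, e) end.

Lemma lform_line x p (v : int * int) t :
  lform x (line_along p v t) = lform x p + 2 * t * (dform x v)%:~R.
Proof. by case: x; rewrite /= ?intrN ?intrD !intrM; ring. Qed.

Lemma std_point_kappa z (v : int * int) (l : int) : 0 < l -> l = dform z v + dform (nxt z) v ->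
  (-1)%:~R < kappa v (std_point z (2 * l%:~R)^-1) < (-1)%:~R + 1.
Proof.
move=> l0 lE; have lR : l%:~R != 0 :> R by rewrite intr_eq0 gt_eqF.
suff -> : kappa v (std_point z (2 * l%:~R)^-1) = - 2^-1 by rewrite intrN; lra.
have -> : kappa v (std_point z (2 * l%:~R)^-1) = - (2 * l%:~R)^-1 * l%:~R.
  by rewrite {3}lE /kappa; case: (z) => /=; rewrite !(intrD, intrN) /=; ring.
by field.
Qed.

Lemma std_line_hol z (v : int * int) (X l : int) : 0 < l -> 0 <= X <= l ->
  X = dform (nxt z) v -> l = dform z v + dform (nxt z) v ->
  \forall N \near \oo,
    F3_conj (hol N (line_along (std_point z (2 * l%:~R)^-1) v)) (F3_of (line_word z X l)).
Proof.
move=> l0 Xl XE lE; have lR : l%:~R != 0 :> R by rewrite intr_eq0 gt_eqF.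
have Y : dform z v = l - X by rewrite XE lE; ring.
apply: line_hol => //.
- apply: line_along_closed => t; apply: (@kappa_itv_not_lattice _ v (-1)).
  by rewrite kappa_line; apply: std_point_kappa.
- move=> t; rewrite lform_line Y intrD intrN.
  by case: (z) => /=; field.
- move=> t; rewrite lform_line -XE.
  by case: (z) => /=; field.
Qed.

Lemma sector_gt0 z e (v : int * int) : coprimez v.1 v.2 -> sector z e v ->
  0 < (-1) ^+ e * (dform z v + dform (nxt z) v).
Proof.
move=> cv [Y0 X0]; rewrite mulrDr lt_neqAle addr_ge0 // andbT; apply/eqP => l0.
have h1 : dform z v = 0 by move: l0 Y0 X0; case: e; rewrite ?expr0 ?expr1; lia.
have h2 : dform (nxt z) v = 0 by move: l0 Y0 X0; case: e; rewrite ?expr0 ?expr1; lia.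
have [v1 v2] : v.1 = 0 /\ v.2 = 0 by move: h1 h2; case: (z) => /=; lia.
by move: cv; rewrite v1 v2.
Qed.

(** The standard line has [kappa] in (-1, 0). Even translations shift [kappa] by any even integer,
    which settles an odd floor; for an even floor a point reflection is needed, at the cost of
    reversing the curve, hence the inverse. *)
Lemma line_along_hol z (v : int * int) p : coprimez v.1 v.2 -> sector z false v ->
  (forall t, ~ lattice (line_along p v t)) ->
  \forall N \near \oo, conj_or_inv (hol N (line_along p v))
    (F3_of (line_word z (dform (nxt z) v) (dform z v + dform (nxt z) v))).
Proof.
move=> cv sv; have := sector_gt0 cv sv; have [] := sv.
rewrite !expr0 !mul1r; set l := _ + _ => Y0 X0 l0 nl; have Lc := line_along_closed nl.
have Xl : 0 <= dform (nxt z) v <= l by rewrite X0 /=; move: Y0; rewrite /l; lia.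
have H := std_line_hol (z := z) (v := v) l0 Xl erefl erefl.
set m := std_point z _ in H.
have kint := kappa_not_int cv nl; set k := kappa v p in kint.
have [k1 k2] := int_gap kint erefl; set n := Num.floor k in k1 k2.
have km := std_point_kappa l0 erefl; rewrite -/m in km.
have [on|en] := boolP (oddz n).
  have [u uE] := kappa_bezout (- ((n + 1) %/ 2)%Z) cv.
  have nE : n = - 2 * (v.1 * u.2 - v.2 * u.1) - 1 by move: on; rewrite uE /oddz; lia.
  pose g (q : plane R) : plane R := q + ((2 * u.1)%:~R : R, (2 * u.2)%:~R : R).
  have gE t : g (line_along p v t) = line_along (g p) v t.
    by rewrite /g /line_along; congr (_, _) => /=; ring.
  have kg : (-1)%:~R < kappa v (g p) < (-1)%:~R + 1.
    have -> : kappa v (g p) = k + 2 * (v.1 * u.2 - v.2 * u.1)%:~R.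
      by rewrite /g /k /kappa /= !(intrD, intrN, intrM); ring.
    have := congr1 (fun a : int => a%:~R : R) nE.
    by rewrite /= !(intrD, intrN, intrM); lra.
  have := hol_homotopy (line_slide km kg (Gamma_shift R u) gE).
  apply: filterS2 H => N h1 h2; left.
  exact: F3_conj_trans (F3_conj_sym h2) h1.
have [u uE] := kappa_bezout (n %/ 2)%Z cv.
have nE : n = 2 * (v.1 * u.2 - v.2 * u.1) by move: en; rewrite uE /oddz; lia.
pose g (q : plane R) : plane R := - q + ((2 * u.1)%:~R : R, (2 * u.2)%:~R : R).
have Gg : Gamma g by exists true, u.1, u.2.
have gE t : g (rev_curve (line_along p v) t) = line_along (g p) v t.
  by rewrite /g /rev_curve /line_along; congr (_, _) => /=; ring.
have kg : (-1)%:~R < kappa v (g p) < (-1)%:~R + 1.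
  have -> : kappa v (g p) = - k + 2 * (v.1 * u.2 - v.2 * u.1)%:~R.
    by rewrite /g /k /kappa /= !(intrD, intrN, intrM); ring.
  have := congr1 (fun a : int => a%:~R : R) nE.
  by rewrite /= !(intrD, intrN, intrM); lra.
have := hol_homotopy (line_slide km kg Gg gE).
move=> h2; near=> N; right.
have hr : hol N (rev_curve (line_along p v)) = (hol N (line_along p v))^-1%g.
  by near: N; apply: hol_rev.
have h1 : F3_conj (hol N (line_along m v)) (F3_of (line_word z (dform (nxt z) v) l)).
  by near: N; exact: H.
have h3 : F3_conj (hol N (line_along m v)) (hol N (rev_curve (line_along p v))).
  by near: N; exact: h2.
have := F3_conj_inv (F3_conj_trans (F3_conj_sym h3) h1).
by rewrite hr invgK.
Unshelve. all: by end_near. Qed.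

Lemma line_along_sector_hol z e (v : int * int) p : coprimez v.1 v.2 -> sector z e v ->
  (forall t, ~ lattice (line_along p v t)) ->
  \forall N \near \oo, conj_or_inv (hol N (line_along p v))
    (F3_of (line_word z ((-1) ^+ e * dform (nxt z) v)
        ((-1) ^+ e * (dform z v + dform (nxt z) v)))).
Proof.
case: e; last by rewrite !expr0 !mul1r; apply: line_along_hol.
rewrite !expr1 !mulN1r => cv [Y0 X0] nl; pose v' := (- v.1, - v.2).
have dE x : dform x v' = - dform x v by case: x => //=; ring.
have cv' : coprimez v'.1 v'.2 by rewrite /= coprimezN coprimeNz.
have sv' : sector z false v' by rewrite /sector !dE; move: Y0 X0; rewrite expr0 expr1; lia.
have revE : line_along p v = rev_curve (line_along p v').
  apply: funext => t; rewrite /rev_curve /line_along; congr (_, _) => /=; rewrite !mulrN !intrN; ring.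
have nl' t : ~ lattice (line_along p v' t).
  by have := nl (- t); rewrite revE /rev_curve opprK.
have := line_along_hol cv' sv' nl'; rewrite !dE -opprD => H.
have Hr := hol_rev (line_along_closed nl').
near=> N; rewrite revE.
have -> : hol N (rev_curve (line_along p v')) = (hol N (line_along p v'))^-1%g by near: N.
apply: (@conj_or_inv_trans (hol N (line_along p v'))); last by near: N.
by right; exact: F3_conj_refl.
Unshelve. all: by end_near. Qed.

Lemma slope_dir_coprime (s : option rat) : coprimez (slope_dir s).1 (slope_dir s).2.
Proof.
case: s => [q|] //=.
by rewrite /coprimez gcdzC; apply: coprime_num_den.
Qed.

Theorem represents_line_word (C : set (R -> plane R)) (u : word) (s : option rat) z (e : bool) :
  let v := slope_dir s in
  let lw := line_word z ((-1) ^+ e * dform (nxt z) v)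
     ((-1) ^+ e * (dform z v + dform (nxt z) v)) in
  simple_classes C -> represents u C -> has_slope C s -> sector z e v ->
  is_rot u lw \/ is_rot u (winv lw).
Proof.
move=> v lw [c0 [C0 _] ->] [cu [c Cc cw]] [x nl Cx] sv.
have cv := slope_dir_coprime s.
have H1 := curve_class_hol C0 Cc; have H2 := curve_class_hol C0 Cx.
have H3 := crossing_word_hol (proj1 Cc) cw.
have H4 := line_along_sector_hol cv sv nl.
have l0 := sector_gt0 cv sv.
have clw : cyc_reduced lw by apply: cyc_reduced_line_word.
have H : \forall N \near \oo, conj_or_inv (F3_of u) (F3_of lw).
  near=> N; apply: (@conj_or_inv_trans (hol N c)).
    by apply: conj_or_inv_sym; left; near: N; exact: H3.
  apply: (@conj_or_inv_trans (hol N c0)).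
    by apply: conj_or_inv_sym; near: N; exact: H1.
  apply: (@conj_or_inv_trans (hol N (line_curve x s))); first by near: N; exact: H2.
  by near: N; exact: H4.
have [N _ /(_ N (leqnn N)) []] := H.
- by left; apply: F3_conj_cyc_reduced.
- by rewrite -F3_of_winv => h; right; apply: F3_conj_cyc_reduced; rewrite ?cyc_reduced_winv.
Unshelve. all: by end_near. Qed.

End Represents.

(** * Recurrence of blocks *)

(** The effect on heights of an even translation, or of a point reflection that exchanges the two
    blocks; the [- 1] comes from floor (- y) = - 1 - floor y off the integers. *)
Definition block_match (E : int -> int) (s t M : int) : Prop :=
  (exists c, oddz (t - s) = false /\
     forall i, 0 <= i < M -> E (t + i) = E (s + i) + 2 * c) \/
  (exists c, oddz (t + s + M - 1) = false /\
     forall i, 0 <= i < M -> E (t + i) = 2 * c - 1 - E (s + M - 1 - i)).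

Lemma int_seq_bracket (P : int -> int) (t : int) :
  (forall k, P k < P (k + 1)) -> exists k, P k < t <= P (k + 1).
Proof.
move=> Pinc.
have dn (n : nat) : P (- n%:Z) <= P 0 - n%:Z.
  elim: n => [|n IH]; first by rewrite !oppr0 addr0.
  have := Pinc (- n.+1%:Z); have -> : - n.+1%:Z + 1 = - n%:Z by lia.
  by lia.
have [k kt] : exists k, P k < t.
  by exists (- (absz (P 0 - t + 1))%:Z); have := dn (absz (P 0 - t + 1)); lia.
have up (n : nat) j : P j < t -> t <= P j + n%:Z -> exists k', P k' < t <= P (k' + 1).
  elim: n j => [|n IH] j jt h; first by lia.
  have [h1|h1] := boolP (t <= P (j + 1)); first by exists j; rewrite jt.
  by apply: (IH (j + 1)); have := Pinc j; lia.
by apply: (up (absz (t - P k)) k kt); lia.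
Qed.

Lemma int_residue (L a r : int) : 0 < L -> exists n, a <= r + n * L <= a + L - 1.
Proof.
move=> L0; exists (- ((r - a) %/ L)%Z).
have e := divz_eq (r - a) L; have h1 := ltz_pmod (r - a) L0.
have h2 := modz_ge0 (r - a) (lt0r_neq0 L0).
by rewrite mulNr; lia.
Qed.

Section Recurrence.
Variables (A B l1 q1 l2 q2 : int).
Hypotheses (A0 : 0 < A) (B0 : 0 < B) (l1_ge : 10 <= l1).
Hypotheses (l2_ge : l1 - 1 <= l2) (det1 : l1 * q2 - q1 * l2 = 1).

Let l := A * l1 + B * l2.
Let q := A * q1 + B * q2.
Let E := line_height q l.
Let M := l1 - 3.

(* k (l2, q2) + row_top k (l1, q1) is the last lattice point of its row strictly
   above the line of slope q / l through the origin; strip_end k is its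
   abscissa. *)
Definition row_top (k : int) : int := ((k * A - 1) %/ B)%Z.
Definition strip_end (k : int) : int := k * l2 + row_top k * l1.

Let row_topP k : row_top k * B + 1 <= k * A <= row_top k * B + B.
Proof. by rewrite /row_top; lia. Qed.

Let row_top_mono k : row_top k <= row_top (k + 1).
Proof. by apply: lez_pdiv2r; [exact: ltW | lia]. Qed.

(** The candidate height [e] puts (j, e) in a row [r <= k] and (j, e + 1) in the row
    [r + l1 >= k + 1]. The lower bound on [j] places the first point beyond [row_top k], hence not
    above the line; the upper bound places the second one strictly above it. *)
Lemma line_height_strip k j : strip_end k < j < strip_end (k + 1) + l1 ->
  E j = ((k + j * q1) %/ l1)%Z.
Proof.
move=> /andP[j1 j2]; set e := ((k + j * q1) %/ l1)%Z.
have l10 : 0 < l1 by lia.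
have l20 : 0 < l2 by lia.
pose r := e * l1 - j * q1; pose a := j * q2 - e * l2.
have r1 : k - l1 < r <= k by rewrite /r /e; lia.
have jE : j = r * l2 + a * l1.
  by rewrite -[LHS]mulr1 -det1 /r /a; ring.
have lo : r * A <= a * B.
  have h : row_top k + 1 <= a.
    have h1 : 0 < (a - row_top k) * l1 - (k - r) * l2 by move: j1; rewrite jE /strip_end; lia.
    have h2 : 0 <= (k - r) * l2 by apply: mulr_ge0; lia.
    have : 0 < (a - row_top k) * l1 by lia.
    by rewrite pmulr_lgt0 //; lia.
  have /andP[_ h3] := row_topP k.
  have h4 : (row_top k + 1) * B <= a * B by rewrite ler_pM2r.
  have h5 : r * A <= k * A by rewrite ler_pM2r //; lia.
  by lia.
have hi : (a - l2) * B < (r + l1) * A.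
  have h : a - l2 <= row_top (k + 1).
    have h1 : 0 < (row_top (k + 1) + 1 - (a - l2)) * l1 - (r + l1 - (k + 1)) * l2.
      by move: j2; rewrite jE /strip_end; lia.
    have h2 : 0 <= (r + l1 - (k + 1)) * l2 by apply: mulr_ge0; lia.
    have : 0 < (row_top (k + 1) + 1 - (a - l2)) * l1 by lia.
    by rewrite pmulr_lgt0 //; lia.
  have /andP[h3 _] := row_topP (k + 1).
  have h4 : (a - l2) * B <= row_top (k + 1) * B by rewrite ler_pM2r.
  have h5 : (k + 1) * A <= (r + l1) * A by rewrite ler_pM2r //; lia.
  by lia.
have l0 : 0 < l by rewrite /l addr_gt0 ?mulr_gt0.
have eE : q * j - e * l = a * B - r * A.
  have e1 : q * j - e * l = A * (q1 * j - e * l1) + B * (q2 * j - e * l2) by rewrite /q /l; ring.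
  by rewrite e1 /r /a; ring.
have eE' : q * j - (e + 1) * l = (a - l2) * B - (r + l1) * A.
  have -> : q * j - (e + 1) * l = q * j - e * l - l by ring.
  by rewrite eE /l; ring.
have h1 : e * l <= q * j by lia.
have h2 : q * j < (e + 1) * l by lia.
apply/eqP; rewrite /E /line_height eq_le; apply/andP; split.
  by rewrite -ltzD1 ltz_divLR.
by rewrite lez_divRL.
Qed.

(** The starts [t] of blocks of [M] heights inside the range of [line_height_strip]; the 3 is
    [l1 - M]. *)
Definition in_strip (k t : int) : bool := strip_end k < t <= strip_end (k + 1) + 3.

Let stripE k t i : in_strip k t -> 0 <= i < M -> E (t + i) = ((k + (t + i) * q1) %/ l1)%Z.
Proof. by rewrite /in_strip /M => h hi; apply: line_height_strip; lia. Qed.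

Let det1' : l1 * q2 = 1 + q1 * l2.
Proof. by lia. Qed.

Let div_addM x y : ((x + y * l1) %/ l1)%Z = (x %/ l1)%Z + y.
Proof. by rewrite addrC divzMDl 1?addrC //; lia. Qed.

Let div_opp y : ((- 1 - y) %/ l1)%Z = - 1 - (y %/ l1)%Z.
Proof.
have e := divz_eq y l1; have h1 := ltz_pmod y (_ : 0 < l1); have h2 := modz_ge0 y (_ : l1 != 0).
have -> : - 1 - y = (l1 - 1 - (y %% l1)%Z) + (- 1 - (y %/ l1)%Z) * l1 by rewrite {1}e; ring.
by rewrite div_addM divz_small ?add0r //; lia.
Qed.

Let match_translate k s k' t n : in_strip k s -> in_strip k' t -> oddz (k' - k) = false ->
  t = s + (k' - k) * l2 + 2 * n * l1 -> block_match E s t M.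
Proof.
move=> ks k't kk tE; left; have [d dE] : exists d, k' - k = 2 * d.
  by exists ((k' - k) %/ 2)%Z; move: kk; rewrite /oddz; lia.
exists (d * q2 + n * q1); split.
  rewrite tE dE; have -> : s + 2 * d * l2 + 2 * n * l1 - s = 0 + 2 * (d * l2 + n * l1) by ring.
  by rewrite oddz2.
move=> i iM; rewrite (stripE k't iM) (stripE ks iM).
have -> : k' + (t + i) * q1 = (k + (s + i) * q1) + (2 * (d * q2 + n * q1)) * l1.
  have -> : k' = k + 2 * d by lia.
  have -> : 2 * (d * q2 + n * q1) * l1 = 2 * d * (l1 * q2) + 2 * n * q1 * l1 by ring.
  by rewrite tE dE det1'; ring.
by rewrite div_addM; lia.
Qed.

(** A point reflection turns the floors of row [k] into those of row [- 1 - k], whose parity is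
    opposite; an even translation then leads to row [k']. *)
Let match_reflect k s k' t n : in_strip k s -> in_strip k' t -> oddz (k' - k) ->
  t = (k + k' + 1) * l2 + 2 * n * l1 - s - M + 1 -> block_match E s t M.
Proof.
move=> ks k't kk tE; right; have [d dE] : exists d, k + k' + 1 = 2 * d.
  by exists ((k + k' + 1) %/ 2)%Z; move: kk; rewrite /oddz; lia.
exists (d * q2 + n * q1); split.
  rewrite tE dE; have -> : 2 * d * l2 + 2 * n * l1 - s - M + 1 + s + M - 1 = 0 + 2 * (d * l2 + n * l1) by ring.
  by rewrite oddz2.
move=> i iM.
have -> : s + M - 1 - i = s + (M - 1 - i) by ring.
rewrite (stripE k't iM) (stripE ks (_ : 0 <= M - 1 - i < M)); last by lia.
set y := k + (s + (M - 1 - i)) * q1.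
have -> : k' + (t + i) * q1 = (- 1 - y) + (2 * (d * q2 + n * q1)) * l1.
  have -> : k' = 2 * d - k - 1 by lia.
  have -> : 2 * (d * q2 + n * q1) * l1 = 2 * d * (l1 * q2) + 2 * n * q1 * l1 by ring.
  by rewrite tE dE /y det1'; ring.
by rewrite div_addM div_opp; ring.
Qed.

(* Blocks of odd rows are first reflected, so that equality of phases modulo
   2 l1 makes blocks match. *)
Definition strip_phase (k t : int) : int := if oddz k then (k + 1) * l2 - t - M + 1 else t - k * l2.

Let match_phase k s k' t n : in_strip k s -> in_strip k' t ->
  strip_phase k' t = strip_phase k s + 2 * n * l1 -> block_match E s t M.
Proof.
move=> ks k't; rewrite /strip_phase.
case ok: (oddz k); case ok': (oddz k') => e.
- by apply: (match_translate (n := - n) ks k't); [move: ok ok'; rewrite /oddz; lia | lia].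
- by apply: (match_reflect (n := n) ks k't); [move: ok ok'; rewrite /oddz; lia | lia].
- by apply: (match_reflect (n := - n) ks k't); [move: ok ok'; rewrite /oddz; lia | lia].
- by apply: (match_translate (n := n) ks k't); [move: ok ok'; rewrite /oddz; lia | lia].
Qed.

(** [2 * l1] consecutive starts in one strip meet every phase modulo [2 * l1]. *)
Let match_window k s k' a : in_strip k s -> strip_end k' < a ->
  a + 2 * l1 - 1 <= strip_end (k' + 1) + 3 ->
  exists2 t, a <= t <= a + 2 * l1 - 1 & block_match E s t M.
Proof.
move=> ks a1 a2; have L0 : 0 < 2 * l1 by lia.
case ok: (oddz k').
  have [n nP] := int_residue a ((k' + 1) * l2 - strip_phase k s - M + 1) L0.
  exists ((k' + 1) * l2 - strip_phase k s - M + 1 + n * (2 * l1)) => //.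
  apply: (match_phase (n := - n) ks (k' := k')); first by rewrite /in_strip; lia.
  by rewrite {1}/strip_phase ok; lia.
have [n nP] := int_residue a (strip_phase k s + k' * l2) L0.
exists (strip_phase k s + k' * l2 + n * (2 * l1)) => //.
apply: (match_phase (n := n) ks (k' := k')); first by rewrite /in_strip; lia.
by rewrite {1}/strip_phase ok; lia.
Qed.

(* With h = strip_half k, strip k meets all the phases of [h l1 + 1, (h + 1) l1];
   two consecutive short strips meet complementary halves modulo 2 l1. *)
Definition strip_half (k : int) : int := if oddz k then - row_top (k + 1) - 1 else row_top k.

Let match_half k s k' : in_strip k s ->
  oddz ((strip_phase k s - 1) %/ l1)%Z = oddz (strip_half k') ->
  exists2 t, in_strip k' t & block_match E s t M.
Proof.
move=> ks; set m := ((strip_phase k s - 1) %/ l1)%Z => mo.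
have [n nE] : exists n, strip_half k' - m = 2 * n.
  by exists ((strip_half k' - m) %/ 2)%Z; move: mo; rewrite /oddz; lia.
have l10 : 0 < l1 by lia.
have mP : m * l1 + 1 <= strip_phase k s <= m * l1 + l1 by rewrite /m; lia.
pose phi := strip_phase k s + 2 * n * l1.
have phiP : strip_half k' * l1 + 1 <= phi <= strip_half k' * l1 + l1.
  have -> : strip_half k' = m + 2 * n by lia.
  by rewrite /phi; lia.
have da : 0 <= (row_top (k' + 1) - row_top k') * l1.
  by apply: mulr_ge0; [rewrite subr_ge0; exact: row_top_mono | lia].
move: phiP; rewrite /strip_half; case ok: (oddz k') => phiP.
  have kt : in_strip k' ((k' + 1) * l2 - phi - M + 1).
    move: phiP da; rewrite /in_strip /strip_end /M; move: phi (row_top _) (row_top _) => f a a'.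
    by move: l1_ge l2_ge; clear; lia.
  exists ((k' + 1) * l2 - phi - M + 1) => //.
  by apply: (match_phase (n := n) ks kt); rewrite {1}/strip_phase ok /phi; ring.
have kt : in_strip k' (phi + k' * l2).
  move: phiP da; rewrite /in_strip /strip_end /M; move: phi (row_top _) (row_top _) => f a a'.
  by move: l1_ge l2_ge; clear; lia.
exists (phi + k' * l2) => //.
by apply: (match_phase (n := n) ks kt); rewrite {1}/strip_phase ok /phi; ring.
Qed.

(** If the strip of [t0] has too few starts left, it ends by [t0 + 2 * l1 - 5]. Then there may come
    one short strip, of length [l2], and at most [2 * l1] further starts: this gives the bound. *)
Lemma block_recurrence s t0 :
  exists2 t, t0 <= t <= t0 + 4 * l1 + l2 - 5 & block_match E s t M.
Proof.
have inc k : strip_end k < strip_end (k + 1).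
  have h : 0 <= (row_top (k + 1) - row_top k) * l1.
    by apply: mulr_ge0; [rewrite subr_ge0; exact: row_top_mono | lia].
  by rewrite /strip_end; lia.
have [k ks] := int_seq_bracket s inc; have {}ks : in_strip k s by rewrite /in_strip; lia.
have [k0 /andP[k01 k02]] := int_seq_bracket t0 inc.
have [h|h] := boolP (t0 + 2 * l1 - 1 <= strip_end (k0 + 1) + 3).
  by have [t tP mt] := match_window ks k01 h; exists t => //; lia.
set k1 := k0 + 1 in k02 h.
have step a : strip_end a < strip_end a + 1 by lia.
(* If [row_top] grew, the strip would have length at least [l1 + l2], enough for a full window. *)
have short a : ~~ (strip_end a + 1 + 2 * l1 - 1 <= strip_end (a + 1) + 3) ->
    row_top (a + 1) = row_top a /\ strip_end (a + 1) = strip_end a + l2.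
  move=> ha; have am := row_top_mono a.
  have [e|ne] := eqVneq (row_top (a + 1)) (row_top a).
    by split=> //; rewrite /strip_end e; ring.
  have h1 : 1 * l1 <= (row_top (a + 1) - row_top a) * l1.
    by rewrite ler_pM2r; lia.
  by move: ha h1; rewrite /strip_end; lia.
have [h1|h1] := boolP (strip_end k1 + 1 + 2 * l1 - 1 <= strip_end (k1 + 1) + 3).
  by have [t tP mt] := match_window ks (step k1) h1; exists t => //; lia.
have [a1 e1] := short _ h1.
have [h2|h2] := boolP (strip_end (k1 + 1) + 1 + 2 * l1 - 1 <= strip_end (k1 + 1 + 1) + 3).
  by have [t tP mt] := match_window ks (step (k1 + 1)) h2; exists t => //; lia.
have [a2 e2] := short _ h2.
(* [row_top] has one value r at [k1], [k1 + 1] and [k1 + 2], while the rows alternate in parity: the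
   two halves are r and - r - 1, in some order, of opposite parities. *)
have [ho|ho] : oddz ((strip_phase k s - 1) %/ l1)%Z = oddz (strip_half k1) \/
    oddz ((strip_phase k s - 1) %/ l1)%Z = oddz (strip_half (k1 + 1)).
- have : oddz (strip_half (k1 + 1)) = ~~ oddz (strip_half k1).
    have ok : oddz (k1 + 1) = ~~ oddz k1 by rewrite /oddz; lia.
    rewrite /strip_half ok; case: (oddz k1) => /=; rewrite ?a2 a1 /oddz; lia.
  move=> ->; case: (oddz _); case: (oddz _); by [left | right].
- by have [t tk mt] := match_half ks ho; exists t => //; move: tk; rewrite /in_strip; lia.
- by have [t tk mt] := match_half ks ho; exists t => //; move: tk; rewrite /in_strip; lia.
Qed.

End Recurrence.

Lemma line_height_swap X l j : l != 0 -> line_height (l - X) l j = j + line_height X l (- j).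
Proof.
move=> l0; rewrite /line_height.
have -> : (l - X) * j = j * l + X * - j by ring.
by rewrite divzMDl.
Qed.

Lemma block_match_opp (E E' : int -> int) s t M :
  (forall j, E' j = j + E (- j)) ->
  block_match E' (- (s + M - 1)) (- (t + M - 1)) M -> block_match E s t M.
Proof.
move=> EE; have e u i : E (u + i) = E' (- (u + M - 1) + (M - 1 - i)) + (u + i).
  rewrite EE; have -> : - (- (u + M - 1) + (M - 1 - i)) = u + i by ring.
  by ring.
case=> -[c [od H]]; [left | right].
  have [d dE] : exists d, t - s = 2 * d by exists ((t - s) %/ 2)%Z; move: od; rewrite /oddz; lia.
  exists (c + d); split; first by move: od; rewrite /oddz; lia.
  by move=> i iM; rewrite !e H; [have -> : t = s + 2 * d by [lia]; ring | lia].
have [d dE] : exists d, t + s + M - 1 = 2 * d.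
  by exists ((t + s + M - 1) %/ 2)%Z; move: od; rewrite /oddz; lia.
exists (c + d); split; first by rewrite /oddz; lia.
move=> i iM; rewrite e H; last by lia.
have -> : s + M - 1 - i = s + (M - 1 - i) by ring.
rewrite (e s); have -> : - (s + M - 1) + (M - 1 - (M - 1 - i)) = - (s + M - 1) + i by ring.
have -> : - (s + M - 1) + M - 1 - (M - 1 - i) = - (s + M - 1) + i by ring.
by lia.
Qed.

(** Replacing the slope X / l by 1 - X / l and reversing positions changes the sign of the
    determinant. Heights change by the position itself, which preserves matching because the offsets
    involved are even. *)
Lemma block_recurrence_abs (A B l1 q1 l2 q2 s t0 : int) :
  0 < A -> 0 < B -> 10 <= l1 -> l1 - 1 <= l2 -> `|l1 * q2 - q1 * l2| = 1 ->
  exists2 t, t0 <= t <= t0 + 4 * l1 + l2 - 5 &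
    block_match (line_height (A * q1 + B * q2) (A * l1 + B * l2)) s t (l1 - 3).
Proof.
move=> A0 B0 h1 h2 hd.
have [d1|d1] : l1 * q2 - q1 * l2 = 1 \/ l1 * q2 - q1 * l2 = -1 by lia.
  exact: block_recurrence.
have d1' : l1 * (l2 - q2) - (l1 - q1) * l2 = 1.
  have -> : l1 * (l2 - q2) - (l1 - q1) * l2 = - (l1 * q2 - q1 * l2) by ring.
  by rewrite d1.
set S := 4 * l1 + l2 - 5; set M := l1 - 3.
have [t tP mt] := block_recurrence A0 B0 h1 h2 d1' (- (s + M - 1)) (- (t0 + S + M - 1)).
exists (- (t + M - 1)); first by move: tP; rewrite /S; lia.
have l0 : A * l1 + B * l2 != 0.
  have : 0 < A * l1 + B * l2 by rewrite addr_gt0 // mulr_gt0 //; lia.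
  by lia.
apply: block_match_opp (fun j => line_height_swap (A * q1 + B * q2) j l0) _.
have -> : - (- (t + M - 1) + M - 1) = t by ring.
have -> : A * l1 + B * l2 - (A * q1 + B * q2) = A * (l1 - q1) + B * (l2 - q2) by ring.
exact: mt.
Qed.

(** * Segments of the periodic line word and their factorization *)

Definition line_segment z X l (a : int) (m : nat) : word :=
  mkseq (fun i => line_letter z X l (a + i%:Z)) m.

(** [m] letters use [m + 2] heights, starting one position earlier. A reflection of heights flips
    the parity that gives the sign and swaps the two sides of the test that chooses the generator,
    so it inverts the word. *)
Lemma block_match_segment z X l s t (m : nat) :
  block_match (line_height X l) (s - 1) (t - 1) (m%:Z + 2) ->
  line_segment z X l t m = line_segment z X l s m \/
  line_segment z X l t m = winv (line_segment z X l s m).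
Proof.
case=> -[c [od H]]; [left | right].
  apply: (@eq_from_nth _ (ga, false)); rewrite !size_mkseq // => i im.
  rewrite !nth_mkseq // /line_letter.
  have -> : oddz (t + i%:Z) = oddz (s + i%:Z) by move: od; rewrite /oddz; lia.
  have E0 : line_height X l (t + i%:Z) = line_height X l (s + i%:Z) + 2 * c.
    have := H (i%:Z + 1); have -> : t - 1 + (i%:Z + 1) = t + i%:Z by ring.
    by have -> : s - 1 + (i%:Z + 1) = s + i%:Z by [ring]; apply; lia.
  have E1 : line_height X l (t + i%:Z - 1) = line_height X l (s + i%:Z - 1) + 2 * c.
    have := H i%:Z; have -> : t - 1 + i%:Z = t + i%:Z - 1 by ring.
    by have -> : s - 1 + i%:Z = s + i%:Z - 1 by [ring]; apply; lia.
  have E2 : line_height X l (t + i%:Z + 1) = line_height X l (s + i%:Z + 1) + 2 * c.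
    have := H (i%:Z + 2); have -> : t - 1 + (i%:Z + 2) = t + i%:Z + 1 by ring.
    by have -> : s - 1 + (i%:Z + 2) = s + i%:Z + 1 by [ring]; apply; lia.
  rewrite E0 E1 E2 oddz2.
  have e a : ((a + 2 * c) %/ 2)%Z = (a %/ 2)%Z + c by lia.
  by rewrite !e (inj_eq (addIr _)).
apply: (@eq_from_nth _ (ga, false)); first by rewrite size_winv !size_mkseq.
rewrite size_mkseq => i im.
rewrite nth_mkseq // /winv nth_rev size_map size_mkseq // (nth_map (ga, false)) ?size_mkseq; last lia.
rewrite nth_mkseq; last lia.
have -> : (m - i.+1)%N%:Z = m%:Z - 1 - i%:Z by lia.
set j := s + _; pose y := t + i%:Z; rewrite -/y.
have F k : -1 <= k <= 1 -> line_height X l (y + k) = 2 * c - 1 - line_height X l (j - k).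
  move=> hk; have := H (i%:Z + 1 + k).
  have -> : t - 1 + (i%:Z + 1 + k) = y + k by rewrite /y; ring.
  have -> : s - 1 + (m%:Z + 2) - 1 - (i%:Z + 1 + k) = j - k by rewrite /j; ring.
  by apply; lia.
have oj : oddz y = oddz j by move: od; rewrite /y /j /oddz; lia.
rewrite /line_letter oj.
have := F 0 isT; rewrite addr0 subr0 => ->; rewrite (F 1) // (F (-1)) // opprK.
have o1 a : oddz (2 * c - 1 - a) = ~~ oddz a by rewrite /oddz; lia.
have e a : ((2 * c - 1 - a) %/ 2)%Z = c - 1 - (a %/ 2)%Z by lia.
rewrite o1 !e; case: (oddz j) => //=.
rewrite (inj_eq (addrI _)) eqr_opp eq_sym.
by case: ifP.
Qed.

Lemma segment_cat z X l a (m n : nat) :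
  line_segment z X l a (m + n)%N = line_segment z X l a m ++ line_segment z X l (a + m%:Z) n.
Proof.
rewrite /line_segment /mkseq iotaD map_cat add0n; congr (_ ++ _).
rewrite -[m in iota m _]addn0 iotaDl -map_comp; apply: eq_map => i /=.
by rewrite PoszD addrA.
Qed.

Lemma size_segment z X l a m : size (line_segment z X l a m) = m.
Proof. exact: size_mkseq. Qed.

(** Every window of [K] letters contains an occurrence starting at offset at most [S]; it is
    isolated, the window is completed by [S - x] letters, and the cutting resumes after it. *)
Lemma greedy_factors z X l (w : word) (K S : nat) :
  (0 < K)%N -> K = (S + size w)%N ->
  (forall a : int, exists2 b : int, a <= b <= a + S%:Z &
      line_segment z X l b (size w) = w \/ line_segment z X l b (size w) = winv w) ->
  forall n a, exists D : seq (bool * word),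
    [/\ line_segment z X l a n = flatten (map snd D),
        forall d, d \in D -> d.1 -> d.2 = w \/ d.2 = winv w &
        sumn [seq size d.2 | d <- D & d.1] = (size w * (n %/ K))%N].
Proof.
move=> K0 KE occ n; have [N] := ubnP n; elim: N n => // N IH n nN a.
have [nK|nK] := ltnP n K.
  exists [:: (false, line_segment z X l a n)]; split => /=; first by rewrite cats0.
    by move=> d; rewrite inE => /eqP ->.
  by rewrite divn_small // muln0.
have [b /andP[ab ba] bw] := occ a.
have [x xE] : exists x : nat, b = a + x%:Z by exists (absz (b - a)); lia.
have xS : (x <= S)%N by lia.
have [] := IH (n - K)%N _ (a + K%:Z); first by lia.
move=> D [DE Dw Ds].
exists [:: (false, line_segment z X l a x), (true, line_segment z X l b (size w)),
   (false, line_segment z X l (b + (size w)%:Z) (S - x)) & D]; split.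
- rewrite /= -DE.
  have -> : n = (x + (size w + ((S - x) + (n - K))))%N by lia.
  rewrite !segment_cat -xE; congr (_ ++ (_ ++ (_ ++ _))).
  by have -> : (x + (size w + (S - x + (n - K))) - K)%N = (n - K)%N by [lia]; congr line_segment; lia.
- move=> d; rewrite !inE => /or4P[/eqP ->|/eqP ->|/eqP ->|dD] //; exact: Dw.
rewrite /= Ds size_segment.
have -> : n = (K + (n - K))%N by lia.
by rewrite divnDl // divnn K0 mulnDr muln1; have -> : (K + (n - K) - K)%N = (n - K)%N by lia.
Qed.

Lemma segment_period z X l a m : l != 0 -> line_segment z X l (a + 2 * l) m = line_segment z X l a m.
Proof.
move=> l0; apply: eq_map => i; rewrite -(line_letter_period z X (a + i%:Z) l0).
by congr line_letter; ring.
Qed.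

Lemma rot_line_word z X l k : 0 < l ->
  exists a, rot k (line_word z X l) = line_segment z X l a (2 * `|l|).
Proof.
move=> l0; set n := (2 * `|l|)%N.
have wE : line_word z X l = line_segment z X l 0 n by apply: eq_map => i; rewrite add0r.
have [kn|nk] := leqP k n; last first.
  by exists 0; rewrite rot_oversize ?wE // size_mkseq ltnW.
exists k%:Z; rewrite wE.
have nE : n = (k + (n - k))%N by lia.
have nE' : n = ((n - k) + k)%N by lia.
rewrite [in LHS]nE segment_cat -{1}(size_segment z X l 0 k) rot_size_cat.
rewrite add0r [in RHS]nE' segment_cat; congr (_ ++ _).
rewrite -(segment_period z X 0 k (_ : l != 0)); last by lia.
by congr line_segment; rewrite /n; lia.
Qed.

Lemma infix_segment z X l a n v : infix v (line_segment z X l a n) ->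
  exists b, v = line_segment z X l b (size v).
Proof.
case/infixP => p [s E]; have := congr1 size E; rewrite !size_cat size_segment => nE.
exists (a + (size p)%:Z); move: E; rewrite nE !segment_cat => /eqP.
rewrite eqseq_cat ?size_segment // => /andP[_]; rewrite eqseq_cat ?size_segment //.
by move=> /andP[/eqP].
Qed.

Lemma cyclic_subword_rot v u1 u2 : is_rot u1 u2 -> cyclic_subword v u1 -> cyclic_subword v u2.
Proof.
move=> /is_rot_sym[i ->] [k vk]; move: vk; rewrite rot_rot_add => h.
by eexists; exact: h.
Qed.

Lemma winv_rot k u : winv (rot k u) = rotr k (winv u).
Proof. by rewrite /winv map_rot rev_rot. Qed.

Lemma is_rot_winv u v : is_rot u v -> is_rot (winv u) (winv v).
Proof. by case=> k ->; rewrite winv_rot; eexists. Qed.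

Lemma cyclic_subword_winv v u : cyclic_subword v (winv u) -> cyclic_subword (winv v) u.
Proof.
case=> k /infixP[p [s E]].
have [j jE] : is_rot u (winv (rot k (winv u))).
  by rewrite winv_rot winvK; eexists.
exists j; rewrite -jE E !winv_cat -catA; apply/infixP.
by exists (winv s), (winv p).
Qed.

(** Working in the bi-infinite periodic word removes cyclic permutations; the inverse absorbs the
    orientation. *)
Definition line_subword z X l (v : word) : Prop :=
  exists a, v = line_segment z X l a (size v) \/ winv v = line_segment z X l a (size v).

Lemma cyclic_subword_line z X l u v : 0 < l ->
  is_rot u (line_word z X l) \/ is_rot u (winv (line_word z X l)) ->
  cyclic_subword v u \/ cyclic_subword v (winv u) -> line_subword z X l v.
Proof.
move=> l0 hu hv.
have {hu hv} [[k vk]|/cyclic_subword_winv[k vk]] :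
    cyclic_subword v (line_word z X l) \/ cyclic_subword v (winv (line_word z X l)).
  case: hu hv => hu [hv|hv].
  - by left; apply: cyclic_subword_rot hu hv.
  - by right; apply: cyclic_subword_rot (is_rot_winv hu) hv.
  - by right; apply: cyclic_subword_rot hu hv.
  - by left; apply: cyclic_subword_rot hv; rewrite -[X in is_rot _ X]winvK; apply: is_rot_winv.
- have [a aE] := rot_line_word z X k l0; move: vk; rewrite aE => /infix_segment[b ->].
  by exists b; left; rewrite size_segment.
have [a aE] := rot_line_word z X k l0; move: vk; rewrite aE => /infix_segment[b bE].
by exists b; right; rewrite [LHS]bE size_winv.
Qed.

Lemma size_cyclic_subword v u : cyclic_subword v u \/ cyclic_subword v (winv u) ->
  (size v <= size u)%N.
Proof.
by case=> -[k /size_infix]; rewrite size_rot ?size_winv.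
Qed.

Lemma line_factors z (A B l1 q1 l2 q2 : int) (W w : word) :
  let X := A * q1 + B * q2 in let l := A * l1 + B * l2 in
  0 < A -> 0 < B -> 10 <= l1 -> l1 - 1 <= l2 <= 2 * l1 + 1 -> `|l1 * q2 - q1 * l2| = 1 ->
  line_subword z X l W -> line_subword z X l w -> (size w)%:Z = l1 - 5 ->
  3 * (l2 + l1 + 1) <= (size W)%:Z ->
  exists D : seq (bool * word),
    [/\ W = flatten (map snd D),
        forall d, d \in D -> d.1 -> d.2 = w \/ d.2 = winv w &
        (size W <= 30 * sumn [seq size d.2 | d <- D & d.1])%N].
Proof.
move=> X l A0 B0 h1 /andP[h2 h3] hd [a aW] [b bw] sw sW.
pose S := absz (4 * l1 + l2 - 5)%R.
have SE : S%:Z = 4 * l1 + l2 - 5 by rewrite /S; lia.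
have occ t0 : exists2 t : int, t0 <= t <= t0 + S%:Z &
    line_segment z X l t (size w) = w \/ line_segment z X l t (size w) = winv w.
  have [t tP mt] := block_recurrence_abs (b - 1) (t0 - 1) A0 B0 h1 h2 hd.
  exists (t + 1); first by lia.
  have := @block_match_segment z X l b (t + 1) (size w).
  rewrite sw addrK (_ : l1 - 5 + 2 = l1 - 3); last by lia.
  move=> /(_ mt); case: bw => [<- //|bw] [] ->; rewrite -bw ?winvK; by [left | right].
have [D [DE Dw Ds]] := greedy_factors (K := (S + size w)%N) ltac:(lia) erefl occ (size W) a.
(* The window is 5 l1 + l2 - 10 <= 7 l1 - 9 <= 15 (l1 - 5) as l1 >= 10. Since W contains f >= 1 full
   windows, its length is below f + 1 <= 2 f of them: whence 30. *)
have bound : (size W <= 30 * (size w * (size W %/ (S + size w))))%N.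
  have K15 : (S + size w <= 15 * size w)%N by lia.
  have KW : (S + size w <= size W)%N by lia.
  set K := (S + size w)%N in K15 KW *.
  have K0 : (0 < K)%N by rewrite /K; lia.
  have q1' : (1 <= size W %/ K)%N by rewrite leq_divRL // mul1n.
  have hq := ltn_ceil (size W) K0.
  have hm : (K * (size W %/ K) <= 15 * size w * (size W %/ K))%N by rewrite leq_mul2r K15 orbT.
  have hK : (K <= K * (size W %/ K))%N by rewrite -{1}[K]muln1 leq_mul2l q1' orbT.
  move: hq hm hK; rewrite mulSn mulnC; set u := (K * _)%N; rewrite -mulnA; set y := (size w * _)%N.
  lia.
case: aW => aW.
  by exists D; split => //; [rewrite aW | rewrite Ds].
exists (rev [seq (d.1, winv d.2) | d <- D]); split.
- rewrite -[W]winvK aW DE map_rev -map_comp.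
  elim: (D) => //= d D' IH; rewrite winv_cat IH rev_cons -cats1 flatten_cat /= cats0 //.
- move=> d; rewrite mem_rev => /mapP[d' dD ->] /= /(Dw _ dD) [->|->]; rewrite ?winvK; by [left | right].
rewrite filter_rev map_rev sumn_rev filter_map -map_comp.
rewrite (eq_map (_ : _ =1 (fun d : bool * word => size d.2))) ?Ds // => d /=.
by rewrite size_winv.
Qed.

(** * Continued fractions *)

(* Slopes are handled as primitive directions (denominator, numerator);
   cf_map n is the action on directions of x |-> n_1 + 1/(n_2 + ... + 1/(n_r + 1/x)...). *)
Fixpoint cf_map (n : seq int) (v : int * int) : int * int :=
  if n is m :: n' then let w := cf_map n' v in (w.2, m * w.2 + w.1) else v.

(** [(0, 1)] is the infinite slope, at which the innermost 1/x vanishes. *)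
Definition cf_vec (n : seq int) : int * int := cf_map n (0, 1).

Definition vec_det (u v : int * int) : int := u.1 * v.2 - u.2 * v.1.

Lemma cf_map_cat n1 n2 v : cf_map (n1 ++ n2) v = cf_map n1 (cf_map n2 v).
Proof. by elim: n1 => //= m n1 ->. Qed.

Lemma cf_map_linear n (a b : int) u v :
  cf_map n (a * u.1 + b * v.1, a * u.2 + b * v.2) =
  (a * (cf_map n u).1 + b * (cf_map n v).1, a * (cf_map n u).2 + b * (cf_map n v).2).
Proof. by elim: n => //= m n ->; congr (_, _) => /=; ring. Qed.

Lemma cf_map_det n u v : `|vec_det (cf_map n u) (cf_map n v)| = `|vec_det u v|.
Proof.
elim: n => //= m n <-; rewrite -[RHS]normrN; congr `|_|.
by rewrite /vec_det /=; ring.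
Qed.

Lemma cf_map_coprime n v : coprimez v.1 v.2 -> coprimez (cf_map n v).1 (cf_map n v).2.
Proof.
move=> cv; elim: n => //= m n; move: (cf_map n v) => [a b] /= /coprimezP[[x y] /= e].
by apply/coprimezP; exists (y - m * x, x) => /=; rewrite -e; ring.
Qed.

Definition pos_seq (n : seq int) : bool := all (fun m => 1 <= m) n.

Lemma cf_map_pos n v : pos_seq n -> 0 <= v.1 <= v.2 -> 1 <= v.2 ->
  0 <= (cf_map n v).1 <= (cf_map n v).2 /\ 1 <= (cf_map n v).2.
Proof.
move=> + v1 v2; elim: n => //= m n IH /andP[m1 /IH[h1 h2]].
move: (cf_map n v) h1 h2 => [b a] /= h1 h2.
have : 1 * a <= m * a by rewrite ler_pM2r //; lia.
by lia.
Qed.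

Lemma cf_vec_pos n : pos_seq n -> 0 <= (cf_vec n).1 <= (cf_vec n).2 /\ 1 <= (cf_vec n).2.
Proof. by move=> pn; apply: cf_map_pos. Qed.

Lemma cf_vec_slope n : n != [::] -> pos_seq (behead n) ->
  slope_dir (Some (cf n)) = cf_vec n.
Proof.
move=> n0 pn.
have [d0 e] : 0 < (cf_vec n).1 /\ cf n = (cf_vec n).2%:Q / (cf_vec n).1%:Q.
  elim: n n0 pn => // m [|m' n] IH _ pn.
    by rewrite /cf_vec /= mulr1 addr0 divr1.
  have [_ a1] := cf_vec_pos pn.
  have [||b0 e] := IH; [by [] | by case/andP: pn |].
  split; first exact: lt_le_trans a1.
  rewrite -[cf (m :: m' :: n)]/(m%:Q + (cf (m' :: n))^-1) e.
  rewrite -[cf_vec (m :: m' :: n)]/((cf_vec (m' :: n)).2, m * (cf_vec (m' :: n)).2 + (cf_vec (m' :: n)).1).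
  move: (cf_vec (m' :: n)) a1 b0 => [b a] /= a1 b0.
  have aR : a%:Q != 0 by rewrite intr_eq0; lia.
  have bR : b%:Q != 0 by rewrite intr_eq0; lia.
  by rewrite intrD intrM; field; rewrite aR bR.
have := cf_map_coprime n (erefl : coprimez (0, 1).1 (0, 1).2); rewrite -/(cf_vec n) => cv.
move: (cf_vec n) d0 e cv => [b a] /= d0 -> cv.
have cv' : coprime `|a| `|b| by rewrite coprime_sym.
by rewrite coprimeq_den // coprimeq_num // gt_eqF // gtr0_sg // mul1r gtr0_norm.
Qed.

Definition in_cone (k : int) (v : int * int) : Prop := k * v.1 <= v.2 <= (k + 1) * v.1.

(** The forms vanish at the slopes 0, -1 and infinity, so no interval [k, k + 1] is cut and all
    slopes with integer part [k] share a sector. The bound on the vertical direction, possibly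
    outside that cone, serves the first convergents. *)
Lemma cone_sector (k : int) : exists z e, (forall v, in_cone k v -> sector z e v) /\
  -1 <= (-1) ^+ (e : bool) * (dform z (0, 1) + dform (nxt z) (0, 1)) <= 1.
Proof.
have x0 v : in_cone k v -> 0 <= v.1 by rewrite /in_cone mulrDl mul1r; lia.
have [k0|k0] := boolP (0 <= k).
  exists ga, false; split => // v cv; have v1 := x0 v cv; rewrite /sector expr0 !mul1r /=.
  have : 0 <= k * v.1 by apply: mulr_ge0.
  by move: cv; rewrite /in_cone; lia.
have [k1|k1] := eqVneq k (-1).
  exists gc, true; split => // v cv; have v1 := x0 v cv; rewrite /sector expr1 /=.
  by move: cv; rewrite /in_cone k1; lia.
exists gb, false; split => // v cv; have v1 := x0 v cv; rewrite /sector expr0 !mul1r /=.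
have : (k + 1) * v.1 <= -1 * v.1 by apply: ler_wpM2r => //; lia.
by move: cv; rewrite /in_cone; lia.
Qed.

Lemma cf_map_cone m n v : pos_seq n -> 0 <= v.1 <= v.2 -> 1 <= v.2 ->
  in_cone m (cf_map (m :: n) v).
Proof.
move=> pn h1 h2; have [] := cf_map_pos pn h1 h2; rewrite /in_cone /=.
by move: (cf_map n v) => [b a] /=; rewrite mulrDl; lia.
Qed.

Section LineLength.
Variables (z : gen) (e : bool).
Definition line_len (v : int * int) : int := (-1) ^+ e * (dform z v + dform (nxt z) v).
Definition line_num (v : int * int) : int := (-1) ^+ e * dform (nxt z) v.

Lemma line_len_linear (a b : int) u v :
  line_len (a * u.1 + b * v.1, a * u.2 + b * v.2) = a * line_len u + b * line_len v.
Proof. by rewrite /line_len; case: (z) => /=; ring. Qed.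

Lemma line_num_linear (a b : int) u v :
  line_num (a * u.1 + b * v.1, a * u.2 + b * v.2) = a * line_num u + b * line_num v.
Proof. by rewrite /line_num; case: (z) => /=; ring. Qed.

(** Length and numerator are unimodular coordinates on directions. *)
Lemma line_det u v :
  `|line_len u * line_num v - line_num u * line_len v| = `|vec_det u v|.
Proof.
have s2 : (-1) ^+ e * (-1) ^+ e = 1 :> int by case: (e).
rewrite -normrN; congr `|_|.
transitivity ((-1) ^+ e * (-1) ^+ e * vec_det u v); last by rewrite s2 mul1r.
by rewrite /line_len /line_num /vec_det; case: (z) => /=; ring.
Qed.

Lemma line_len_ge0 v : sector z e v -> 0 <= line_len v.
Proof. by case=> h1 h2; rewrite /line_len mulrDr addr_ge0. Qed.

End LineLength.

(** * Assembly for a given continued fraction *)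

Lemma factors_finfun (D : seq (bool * word)) (W w : word) :
  W = flatten (map snd D) -> (forall d, d \in D -> d.1 -> d.2 = w \/ d.2 = winv w) ->
  (size W <= 30 * sumn [seq size d.2 | d <- D & d.1])%N ->
  exists (q : nat) (u : 'I_q -> word) (I : {set 'I_q}),
    [/\ W = flatten [seq u k | k <- enum 'I_q],
        forall k, k \in I -> u k = w \/ u k = winv w
      & (1 / 30 : rat) * (size W)%:R <= \sum_(k in I) (size (u k))%:R].
Proof.
move=> WE Dw Ds; pose d0 : bool * word := (false, [::]).
exists (size D), (fun k => (nth d0 D k).2), [set k : 'I_(size D) | (nth d0 D k).1]%SET.
split.
- rewrite WE; congr flatten.
  rewrite (map_comp (fun i => (nth d0 D i).2) (@nat_of_ord _)) val_enum_ord.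
  by rewrite (map_comp snd (nth d0 D)) map_nth_iota0 ?take_size.
- by move=> k; rewrite inE; apply: Dw; apply: mem_nth.
have -> : \sum_(k in [set k : 'I_(size D) | (nth d0 D k).1]%SET) (size (nth d0 D k).2)%:R =
    (sumn [seq size d.2 | d <- D & d.1])%:R :> rat.
  rewrite sumnE big_map big_filter (big_nth d0) big_mkord natr_sum.
  by apply: eq_bigl => k; rewrite inE.
have : (size W)%:R <= (30 * sumn [seq size d.2 | d <- D & d.1])%:R :> rat by rewrite ler_nat.
by rewrite natrM; lra.
Qed.

Lemma half_length_line (R : realType) (s l : rat) z (e : bool) :
  sector z e (slope_dir (Some s)) -> half_length R s l ->
  l = (line_len z e (slope_dir (Some s)))%:~R.
Proof.
move=> sv [C [u [SC hs ru ->]]].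
have h := represents_line_word SC ru hs sv.
have -> : size u = (2 * `|line_len z e (slope_dir (Some s))|)%N.
  rewrite -(size_line_word z (line_num z e (slope_dir (Some s)))).
  by case: h => -[k /(congr1 size)]; rewrite ?size_winv size_rot.
rewrite natrM mulrAC divff // mul1r.
by rewrite -[in RHS](gez0_abs (line_len_ge0 sv)).
Qed.

Theorem theorem3p8 (R : realType) (C : set (R -> plane R)) (gamma : word)
    (n : seq int) (i : nat) (l l' : rat) (W w : word) :
  let alpha : rat := 1 / 30 in
  simple_classes C ->
  represents gamma C ->
  cf_expansion n ->
  has_slope C (Some (cf n)) ->
  (i <= size n)%N ->
  special_length R n i l ->
  special_length' R n i l' ->
  10 <= l ->
  cyclic_subword W gamma \/ cyclic_subword W (winv gamma) ->
  3 * (l' + l + 1) <= (size W)%:R ->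
  cyclic_subword w gamma \/ cyclic_subword w (winv gamma) ->
  (size w)%:R = l - 5 ->
  exists (q : nat) (u : 'I_q -> word) (I : {set 'I_q}),
    [/\ W = flatten [seq u k | k <- enum 'I_q],
        forall k, k \in I -> u k = w \/ u k = winv w
      & alpha * (size W)%:R <= \sum_(k in I) (size (u k))%:R].
Proof.
move=> alpha SC rg cfn hs ir hl hl' l10 hW sW hw sw.
have [n0 npos nlast] := cfn.
(* For i = 0 the slope is 0 and the half-length is 1, against [10 <= l]. *)
case: i ir hl hl' => [|j] jr hl hl'.
  have s0 : slope_dir (Some 0) = (1, 0) by [].
  have := half_length_line (z := ga) (e := false) _ hl; rewrite s0.
  by move=> h; move: l10; rewrite h // /sector !expr0.
pose pre := take j n; pose m := nth 0 n j; pose post := drop j.+1 n.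
have nE : n = pre ++ m :: post by rewrite /pre /m /post -drop_nth // cat_take_drop.
have tkE : take j.+1 n = rcons pre m by rewrite (take_nth 0).
have pos_n : pos_seq (behead n).
  apply/(all_nthP 0) => k; rewrite size_behead nth_behead => kn.
  by apply: npos; rewrite /= -ltn_predRL.
have pos_post : pos_seq post.
  move: pos_n; rewrite nE; case: (pre) => [|p pr] //=; rewrite /pos_seq all_cat /=.
  by case/and3P.
have pos_pre m' : (pre != [::] -> 1 <= m') -> pos_seq (behead (rcons pre m')).
  move: pos_n; rewrite nE; case: (pre) => [|p pr] //=; rewrite /pos_seq all_cat all_rcons /=.
  by move=> /andP[-> _] /(_ isT) ->.
have m_pos : pre != [::] -> 1 <= m.
  move: pos_n; rewrite nE; case: (pre) => [|p pr] //=; rewrite /pos_seq all_cat /=.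
  by case/and3P.
have rc m' : rcons pre m' != [::] by case: (pre).
pose V := cf_vec n; pose V1 := cf_map pre (1, m); pose V2 := cf_map pre (1, m + 1).
have VE : slope_dir (Some (cf n)) = V by apply: cf_vec_slope => //; case: (n) n0.
have V1E : slope_dir (Some (special_slope n j.+1)) = V1.
  rewrite /special_slope tkE cf_vec_slope // ?pos_pre // /cf_vec -cats1 cf_map_cat /=.
  by rewrite mulr1 addr0.
have V2E : slope_dir (Some (special_slope' n j.+1)) = V2.
  rewrite /special_slope' cf_vec_slope // ?pos_pre // => [|/m_pos]; last by lia.
  by rewrite /cf_vec -cats1 cf_map_cat /= mulr1 addr0.
pose n1 := head 0 n.
have coneV v : pre != [::] -> 0 <= v.1 <= v.2 -> 1 <= v.2 -> in_cone n1 (cf_map pre v).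
  move: pos_n; rewrite /n1 nE; case: (pre) => [|p pr] //= pp _ h1 h2.
  by apply: cf_map_cone => //; move: pp; rewrite /pos_seq all_cat => /andP[].
have coneV1 : in_cone n1 V1.
  have [p0|p0] := eqVneq pre [::]; last by apply: coneV => //=; have := m_pos p0; lia.
  by rewrite /V1 /n1 nE p0 /in_cone /=; lia.
have coneV2 : in_cone n1 V2.
  have [p0|p0] := eqVneq pre [::]; last by apply: coneV => //=; have := m_pos p0; lia.
  by rewrite /V2 /n1 nE p0 /in_cone /=; lia.
have coneVn : in_cone n1 V.
  have [p0|p0] := eqVneq pre [::].
    by rewrite /V /cf_vec /n1 nE p0; apply: (@cf_map_cone m post (0, 1) pos_post isT isT).
  rewrite /V /cf_vec nE cf_map_cat; have [h1 h2] := cf_vec_pos pos_post.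
  apply: coneV => //=; rewrite -/(cf_vec post).
    have := m_pos p0; have : 1 * (cf_vec post).2 <= m * (cf_vec post).2 by rewrite ler_pM2r; [exact: m_pos | lia].
    by lia.
  have : 1 * (cf_vec post).2 <= m * (cf_vec post).2 by rewrite ler_pM2r; [exact: m_pos | lia].
  by lia.
have [z [e [sec len01]]] := cone_sector n1.
pose len := line_len z e; pose num := line_num z e.
have {}len01 : -1 <= len (0, 1) <= 1 by [].
have lE : l = (len V1)%:~R.
  by have := half_length_line (z := z) (e := e) _ hl; rewrite V1E; apply; apply: sec.
have l'E : l' = (len V2)%:~R.
  by have := half_length_line (z := z) (e := e) _ hl'; rewrite V2E; apply; apply: sec.
have secV : sector z e (slope_dir (Some (cf n))) by rewrite VE; apply: sec.
have rot_g := represents_line_word SC rg hs secV.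
have len10 : 10 <= len V1 by move: l10; rewrite lE -(ler_int rat).
have sw' : (size w)%:Z = len V1 - 5.
  by apply/eqP; rewrite -(eqr_int rat) intrD intrN -lE -sw.
have sW' : 3 * (len V2 + len V1 + 1) <= (size W)%:Z.
  by rewrite -(ler_int rat) intrM !intrD -lE -l'E.
have len2_ge0 : 0 <= len V2 by apply/line_len_ge0/sec.
(* If nothing follows [m], gamma is gamma_i and has [2 * len V1] letters, too few to contain [W]. *)
have [post0|post0] := eqVneq post [::].
  have := size_cyclic_subword hW.
  have -> : size gamma = (2 * `|len V1|)%N.
    have -> : V1 = slope_dir (Some (cf n)) by rewrite VE /V /V1 nE post0 /cf_vec cf_map_cat /= mulr1 addr0.
    rewrite -(size_line_word z (num (slope_dir (Some (cf n))))).
    by case: rot_g => -[k /(congr1 size)]; rewrite ?size_winv size_rot.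
  by move: sW'; lia.
pose b := (cf_vec post).1; pose a := (cf_vec post).2.
(* The remaining quotients turn (1, m) into (a, m a + b) = (a - b) (1, m) + b (1, m + 1). That the
   last quotient is at least 2 makes [a - b] positive. *)
have [a_b b_pos] : 0 < a - b /\ 0 < b.
  rewrite /a /b; have : 2 <= last 0 post.
    have -> : last 0 post = last 0 n by rewrite nE last_cat /=; case: (post) post0.
    apply: nlast; rewrite nE size_cat /=; case: (post) post0 => //= ? ?; lia.
  move: pos_post post0; case: (post) => [|p ps] //= /andP[p1 pps] _.
  have [h1 h2] := cf_vec_pos pps; rewrite /cf_vec /= -/(cf_vec ps).
  have hp : (p - 1) * (cf_vec ps).2 >= 0 by rewrite mulr_ge0; lia.
  case: ps pps h1 h2 hp => [|p' ps'] pps h1 h2 hp.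
    by rewrite /cf_vec /= => p2; split; lia.
  move=> _; have [_ h3] := cf_vec_pos (proj2 (andP pps)).
  have h4 : (cf_vec (p' :: ps')).1 = (cf_vec ps').2 by [].
  by split; lia.
have Vdec : V = ((a - b) * V1.1 + b * V2.1, (a - b) * V1.2 + b * V2.2).
  rewrite /V /V1 /V2 /cf_vec nE cf_map_cat -cf_map_linear; congr cf_map.
  by rewrite /= -/(cf_vec post) -/a -/b; congr (_, _); ring.
have len0 : len V = (a - b) * len V1 + b * len V2 by rewrite {1}Vdec; apply: line_len_linear.
have num0 : num V = (a - b) * num V1 + b * num V2 by rewrite {1}Vdec; apply: line_num_linear.
have det1 : `|len V1 * num V2 - num V1 * len V2| = 1.
  by rewrite line_det cf_map_det /vec_det /=; have -> : 1 * (m + 1) - m * 1 = 1 by ring.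
have V2dec : len V2 = len V1 + len (cf_map pre (0, 1)).
  have -> : V2 = (1 * V1.1 + 1 * (cf_map pre (0, 1)).1, 1 * V1.2 + 1 * (cf_map pre (0, 1)).2).
    by rewrite /V1 /V2 -cf_map_linear; congr cf_map; congr (_, _) => /=; ring.
  by rewrite /len line_len_linear !mul1r.
(* [V2 - V1] is the previous convergent, or the vertical direction when [pre] is empty. [V1] is [m]
   times it plus the convergent before, whose length is nonnegative except perhaps for the vertical
   direction, where it is at least -1: hence the errors of 1. *)
have len2 : len V1 - 1 <= len V2 <= 2 * len V1 + 1.
  rewrite V2dec; have [p0|p0] := eqVneq pre [::].
    move: len01 len10; rewrite p0 [cf_map _ _]/=; move: (len V1) (len (0, 1)) => u v.
    by clear; lia.
  have w0 : 0 <= len (cf_map pre (0, 1)) by apply/line_len_ge0/sec/coneV.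
  suff : len (cf_map pre (0, 1)) <= len V1 + 1 by lia.
  have -> : V1 = (1 * (cf_map pre (1, 0)).1 + m * (cf_map pre (0, 1)).1, 1 * (cf_map pre (1, 0)).2 + m * (cf_map pre (0, 1)).2).
    by rewrite /V1 -cf_map_linear; congr cf_map; congr (_, _) => /=; ring.
  rewrite /len line_len_linear -/len mul1r.
  have hm : 1 * len (cf_map pre (0, 1)) <= m * len (cf_map pre (0, 1)).
    by apply: ler_wpM2r => //; apply: m_pos.
  suff : -1 <= len (cf_map pre (1, 0)) by lia.
  have [pr [p preE]] : exists pr p, pre = rcons pr p.
    by case/lastP: (pre) p0 => // pr p _; exists pr, p.
  rewrite preE -cats1 cf_map_cat /= mulr0 add0r.
  have [q0|q0] := eqVneq pr [::].
    by case/andP: len01; rewrite q0 [cf_map _ _]/=.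
  suff : 0 <= len (cf_map pr (0, 1)) by apply: le_trans.
  apply/line_len_ge0/sec; move: pos_n; rewrite /n1 nE preE.
  case: (pr) q0 => [|q qs] //= _ qp; apply: cf_map_cone => //.
  by move: qp; rewrite /pos_seq cat_rcons all_cat => /andP[].
have l_gt0 : 0 < len V by rewrite len0; nia.
rewrite VE in rot_g.
have lsW := cyclic_subword_line l_gt0 rot_g hW.
have lsw := cyclic_subword_line l_gt0 rot_g hw.
have [D [DE Dw Ds]] : exists D : seq (bool * word),
    [/\ W = flatten (map snd D),
        forall d, d \in D -> d.1 -> d.2 = w \/ d.2 = winv w &
        (size W <= 30 * sumn [seq size d.2 | d <- D & d.1])%N].
  apply: (line_factors a_b b_pos len10 len2 det1 _ _ sw' sW'); rewrite -len0 -num0.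
    exact: lsW.
  exact: lsw.
exact: factors_finfun DE Dw Ds.
Qed.
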